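(* Let $G$ be a group and $\ell$ a commutative unital ring with involution containing $\lambda$ with $\lambda+\lambda^*=1$. The crossed product functors $-\rtimes G$ (from $G$-$*$-algebras to $G$-graded $*$-algebras) and $G\,\widehat{\ltimes}-$ (from $G$-graded $*$-algebras to $G$-$*$-algebras) extend to inverse triangle equivalences $$-\rtimes G:kk^h_G\leftrightarrows kk^h_{G_{\mathrm{gr}}}:G\,\widehat{\ltimes}-.$$
   Context: Algebras. $\ell$-algebras are associative, not necessarily unital. A $*$-algebra is an $\ell$-algebra with additive involution with $(ab)^*=b^*a^*$, $(\mu a)^*=\mu^*a^*$. A $G$-$*$-algebra is a $*$-algebra with an action of $G$ by $*$-automorphisms. A $G$-graded $*$-algebra is a $*$-algebra with a $G$-grading such that $A_g^*\subset A_{g^{-1}}$; morphisms are degree-preserving $*$-homomorphisms. $M_XA$ is the $*$-algebra of finitely supported $X\times X$-matrices with conjugate-transpose involution; for a $G$-set $X$ and $G$-$*$-algebra $A$, $(g\cdot f)(x,y)=g\cdot f(g^{-1}x,g^{-1}y)$; for a $G$-graded set $X$ (a set with a map $|\cdot|:X\to G$) and $G$-graded $A$, $|\varepsilon_{x,y}\otimes a|=|x||a||y|^{-1}$. Plain sets carry the trivial structure. Crossed products. For a $G$-$*$-algebra $A$, $A\rtimes G=A\otimes_\ell\ell[G]$ with $(a\rtimes g)(b\rtimes h)=a(g\cdot b)\rtimes gh$, $(a\rtimes g)^*=g^{-1}\cdot a^*\rtimes g^{-1}$ and $(A\rtimes G)_g=A\rtimes g$. For a $G$-graded $*$-algebra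 $B$, $G\,\widehat{\ltimes}\,B=\ell^{(G)}\otimes B$ with $(\chi_g\,\widehat{\ltimes}\,b)(\chi_h\,\widehat{\ltimes}\,c)=\delta_{h,g|b|}\chi_g\,\widehat{\ltimes}\,bc$, $(\chi_g\,\widehat{\ltimes}\,b)^*=\chi_{g|b|}\,\widehat{\ltimes}\,b^*$ ($b$ homogeneous) and action $h\cdot(\chi_g\,\widehat{\ltimes}\,c)=\chi_{hg}\,\widehat{\ltimes}\,c$. The categories. Fix an infinite set $\mathfrak{X}$ with $\#\mathfrak{X}\ge\#(G\sqcup\mathbb{N})$. On either category, a functor is $M_{\mathfrak{X}}$-stable if it inverts the corner inclusions $A\to M_{\mathfrak{X}}A$ ($\mathfrak X$ with trivial structure); $\iota_+$-stable if it inverts the upper-left corner inclusions $A\to M_\pm A$, $M_\pm A=M_2A$ with involution $x\mapsto hx^*h$, $h=\mathrm{diag}(1,-1)$; an $\iota_+$-stable functor is $G$-stable if it inverts $M_XA\to M_{X\sqcup Y}A$ for all $G$-sets (resp. $G$-graded sets) $X,Y$ of cardinality $\le\#\mathfrak{X}$; homotopy invariant if it inverts $A\to A[t]$ ($t^*=t$, trivial action/degree). An excisive homology theory is a functor $H$ to a triangulated category with maps $\partial:\Omega H(C)\to H(A)$ ($\Omega$ the inverse suspension), for each exact sequence $0\to A\to B\to C\to0$ such that $B\to C$ has a section which is $\ell[G]$-linear (resp. $\ell$-linear and degree-preserving), compatible with morphisms of extensions, making $\Omega H(C)\to H(A)\to H(B)\to H(C)$ distinguished. $j^h_G$ (on $G$-$*$-algebras,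 values in $kk^h_G$) and $j^h_{G_{\mathrm{gr}}}$ (on $G$-graded $*$-algebras, values in $kk^h_{G_{\mathrm{gr}}}$) are the initial $G$-stable, homotopy invariant, $M_{\mathfrak{X}}$-stable, $\iota_+$-stable excisive homology theories; both are the identity on objects. *)

(* Defs.v *)
From HB Require Import structures.
From mathcomp Require Import all_boot all_algebra finmap.
From mathcomp Require Import boolp classical_sets functions cardinality fsbigop.

Set Implicit Arguments.
Unset Strict Implicit.
Unset Printing Implicit Defensive.

Import GRing.Theory.
Local Open Scope classical_set_scope.
Local Open Scope ring_scope.

(* [fs S V]: the finitely supported functions S -> V. As a module it is the
   direct sum of copies of V indexed by S, i.e. l^(S) (x) V, the elementary
   tensor of s and a being [delta s a]. *)
Section FiniteSupport.
Variables (l : comPzRingType) (S : choiceType) (V : lmodType l).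

Definition fs_pred : {pred S -> V} :=
  fun f => `[< finite_set [set s | f s <> 0] >].

Record fs := FS { fs_val :> S -> V; _ : fs_val \in fs_pred }.

HB.instance Definition _ := [isSub for fs_val].
HB.instance Definition _ := [Choice of fs by <:].

Lemma fs_pred_closed : submod_closed fs_pred.
Proof.
split=> [|c f g]; rewrite !unfold_in.
  by apply/asboolP/(sub_finite_set _ (finite_set0 _)) => s /=.
move=> /asboolP ff /asboolP fg; apply/asboolP.
apply: (@sub_finite_set _ _ ([set s | f s <> 0] `|` [set s | g s <> 0])).
  move=> s /= nz; case: (pselect (f s = 0)) => [f0|]; last by left.
  by right=> g0; apply: nz; rewrite -[LHS]/(c *: f s + g s) f0 g0 scaler0 addr0.
by rewrite finite_setU.
Qed.

HB.instance Definition _ :=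
  GRing.isSubmodClosed.Build l (S -> V) fs_pred fs_pred_closed.
HB.instance Definition _ := [SubChoice_isSubLmodule of fs by <:].

Lemma fs_finite (f : fs) : finite_set [set s | f s <> 0].
Proof. by case: f => f /= ff; apply/asboolP. Qed.

Lemma fs_eqP (f g : fs) : (forall s, f s = g s) -> f = g.
Proof. by move=> fg; apply/val_inj/funext. Qed.

Lemma fs0E s : (0 : fs) s = 0. Proof. by []. Qed.
Lemma fsDE (f g : fs) s : (f + g) s = f s + g s. Proof. by []. Qed.
Lemma fsNE (f : fs) s : (- f) s = - f s. Proof. by []. Qed.
Lemma fsZE c (f : fs) s : (c *: f) s = c *: f s. Proof. by []. Qed.

Lemma delta_subproof s (a : V) : (fun t => if t == s then a else 0) \in fs_pred.
Proof.
apply/asboolP; apply: (@sub_finite_set _ _ [set s]) => [t /=|]; last exact: finite_set1.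
by case: eqP.
Qed.

Definition delta s a : fs := FS (delta_subproof s a).

Lemma deltaE s a t : delta s a t = if t == s then a else 0. Proof. by []. Qed.

Lemma deltaD s : {morph delta s : a b / a + b}.
Proof. by move=> a b; apply: fs_eqP => t; rewrite fsDE !deltaE; case: eqP; rewrite ?addr0. Qed.

Lemma deltaZ s c a : delta s (c *: a) = c *: delta s a.
Proof. by apply: fs_eqP => t; rewrite fsZE !deltaE; case: eqP; rewrite ?scaler0. Qed.

Lemma delta0 s : delta s 0 = 0.
Proof. by apply: fs_eqP => t; rewrite deltaE; case: eqP. Qed.

Lemma fs_ind (P : fs -> Prop) : P 0 -> (forall f g, P f -> P g -> P (f + g)) ->
  (forall s a, P (delta s a)) -> forall f, P f.
Proof.
move=> P0 PD Pd f; have /finite_seqP[r hr] := fs_finite f.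
have {hr} : forall s, s \notin r -> f s = 0.
  move=> s; apply: contraNeq => /eqP fs0.
  by have : [set` r] s by rewrite -hr.
elim: r f => [f f0|s r IH f fr].
  by have -> : f = 0 by apply: fs_eqP => s; rewrite f0.
have -> : f = (f - delta s (f s)) + delta s (f s) by rewrite subrK.
apply: PD => //; apply: IH => t tr; rewrite fsDE fsNE deltaE.
case: eqP => [->|/eqP ts]; first by rewrite subrr.
by rewrite subr0 fr // inE negb_or ts.
Qed.

End FiniteSupport.

(* [lext phi] is the additive map determined by delta s a |-> phi s a. *)
Section LinearExtension.
Variables (l : comPzRingType) (S : choiceType) (V : lmodType l).

Definition lext (W : zmodType) (phi : S -> V -> W) (f : fs S V) : W :=
  \sum_(s \in [set: S]) phi s (f s).

Lemma eq_lext (W : zmodType) (phi psi : S -> V -> W) (f : fs S V) :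
  (forall s, phi s (f s) = psi s (f s)) -> lext phi f = lext psi f.
Proof. by move=> e; apply: eq_fsbigr => s _; rewrite e. Qed.

Section Additive.
Variables (W : zmodType) (phi : S -> V -> W).
Hypothesis phiD : forall s, {morph phi s : a b / a + b}.

Let phi0 s : phi s 0 = 0.
Proof. by apply: (addrI (phi s 0)); rewrite -phiD !addr0. Qed.

Lemma lext_widen (D : set S) (f : fs S V) : [set s | f s <> 0] `<=` D ->
  lext phi f = \sum_(s \in D) phi s (f s).
Proof.
move=> fD; apply/esym/fsbig_widen => // s [_ /= nDs].
by have -> : f s = 0 by apply: contrapT => /fD.
Qed.

Lemma lextD : {morph lext phi : f g / f + g}.
Proof.
move=> f g; pose D := [set s | f s <> 0] `|` [set s | g s <> 0].
have Dfin : finite_set D by rewrite finite_setU; split; exact: fs_finite.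
rewrite !(@lext_widen D); first last.
- move=> s /= nz; case: (pselect (f s = 0)) => [f0|]; last by left.
  by right=> g0; apply: nz; rewrite -[LHS]/(f s + g s) f0 g0 addr0.
- by move=> s ?; left.
- by move=> s ?; right.
by rewrite -fsbig_split //; apply: eq_fsbigr => s _; rewrite fsDE phiD.
Qed.

Lemma lext_delta s a : lext phi (delta s a) = phi s a.
Proof.
rewrite (@lext_widen [set s]); first by rewrite fsbig_set1 deltaE eqxx.
by move=> t /=; case: eqP.
Qed.

Lemma lext0 : lext phi 0 = 0.
Proof. by apply: (addrI (lext phi 0)); rewrite -lextD !addr0. Qed.

Lemma lextN f : lext phi (- f) = - lext phi f.
Proof. by apply: (addrI (lext phi f)); rewrite -lextD !subrr lext0. Qed.

Lemma lext_closed (D : W -> Prop) (f : fs S V) : D 0 -> (forall u v, D u -> D v -> D (u + v)) ->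
  (forall s, D (phi s (f s))) -> D (lext phi f).
Proof.
move=> D0 DD Df; rewrite (@lext_widen [set s | f s <> 0]) //.
rewrite fsbig_finite; last exact: fs_finite.
by elim: (fset_set _ : seq S) => [|s r IH]; rewrite ?big_nil ?big_cons //; apply: DD.
Qed.

Lemma lext_unique (psi : fs S V -> W) : {morph psi : f g / f + g} ->
  (forall s a, psi (delta s a) = phi s a) -> psi =1 lext phi.
Proof.
move=> psiD psid; elim/fs_ind => [|f g ef eg|s a].
- by rewrite lext0; apply: (addrI (psi 0)); rewrite -psiD !addr0.
- by rewrite psiD lextD ef eg.
- by rewrite lext_delta psid.
Qed.

End Additive.

Lemma lextZ (W : lmodType l) (sg : l -> l) (phi : S -> V -> W) :
  (forall s, {morph phi s : a b / a + b}) ->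
  (forall s c a, phi s (c *: a) = sg c *: phi s a) ->
  forall c f, lext phi (c *: f) = sg c *: lext phi f.
Proof.
move=> phiD phiZ c; elim/fs_ind => [|f g ef eg|s a].
- by rewrite scaler0 lext0 // scaler0.
- by rewrite scalerDr !lextD // ef eg scalerDr.
- by rewrite -deltaZ !lext_delta // phiZ.
Qed.

End LinearExtension.

Lemma lext_comp (l : comPzRingType) (S : choiceType) (V : lmodType l)
    (W X : zmodType) (phi : S -> V -> W) (psi : W -> X) (f : fs S V) :
  (forall s, {morph phi s : a b / a + b}) -> {morph psi : a b / a + b} ->
  psi (lext phi f) = lext (fun s a => psi (phi s a)) f.
Proof.
move=> phiD psiD.
have compD s : {morph (fun a => psi (phi s a)) : a b / a + b}.
  by move=> a b; rewrite phiD psiD.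
apply: (@lext_unique _ _ _ _ _ compD (fun f => psi (lext phi f))) => [g h|s a].
  by rewrite lextD ?psiD.
by rewrite lext_delta.
Qed.

Record conjugation (l : comPzRingType) := Conjugation {
  conj_fun :> {rmorphism l -> l};
  conj_funK : involutive conj_fun }.

Section StarAlgebras.
Variables (l : comPzRingType) (sg : conjugation l).

Record staralg := StarAlg {
  sa_car :> lmodType l;
  smul : sa_car -> sa_car -> sa_car;
  smulA : associative smul;
  smulDl : left_distributive smul +%R;
  smulDr : right_distributive smul +%R;
  smulZl : forall c a b, smul (c *: a) b = c *: smul a b;
  smulZr : forall c a b, smul a (c *: b) = c *: smul a b;
  star : sa_car -> sa_car;
  starK : involutive star;
  starD : {morph star : a b / a + b};
  starZ : forall c a, star (c *: a) = sg c *: star a;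
  starM : forall a b, star (smul a b) = smul (star b) (star a) }.

Record is_star_hom (A B : staralg) (f : A -> B) : Prop := IsStarHom {
  shL : linear f;
  shM : {morph f : a b / smul a b};
  shS : {morph f : a / star a} }.

Section Theory.
Variables A B : staralg.

Lemma smul0r (a : A) : smul 0 a = 0.
Proof. by have := smulZl (0 : l) 0 a; rewrite !scale0r. Qed.

Lemma smulr0 (a : A) : smul a 0 = 0.
Proof. by have := smulZr (0 : l) a 0; rewrite !scale0r. Qed.

Lemma star0 : star (0 : A) = 0.
Proof. by have := starZ (0 : l) (0 : A); rewrite rmorph0 !scale0r. Qed.

Variables (f : A -> B) (hf : is_star_hom f).

Lemma sh0 : f 0 = 0.
Proof.
by have := shL hf (-1) 0 0; rewrite scaler0 addr0 scaleN1r addNr.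
Qed.

Lemma shD : {morph f : a b / a + b}.
Proof. by move=> a b; have := shL hf 1 a b; rewrite !scale1r. Qed.

Lemma shZ c a : f (c *: a) = c *: f a.
Proof. by have := shL hf c a 0; rewrite sh0 !addr0. Qed.
End Theory.

Lemma star_hom_id (A : staralg) : is_star_hom (@id A).
Proof. by []. Qed.

Lemma star_hom_comp (A B C : staralg) (g : B -> C) (f : A -> B) :
  is_star_hom g -> is_star_hom f -> is_star_hom (g \o f).
Proof.
move=> hg hf; split=> [c a b|a b|a] /=.
- by rewrite (shL hf) (shL hg).
- by rewrite (shM hf) (shM hg).
- by rewrite (shS hf) (shS hg).
Qed.

(* Products and involutions on [fs S A] are given by their values on the
   generators [delta s a], as [gm s a t b] = delta s a * delta t b and
   [gs s a] = (delta s a)^*, and extended biadditively, resp. additively;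
   see [fsmul_delta] and [fsstar_delta]. *)
Section GeneratorLaws.
Variables (S : choiceType) (A : lmodType l).
Variables (gm : S -> A -> S -> A -> fs S A) (gs : S -> A -> fs S A).

Definition fsmul (f g : fs S A) : fs S A :=
  lext (fun s a => lext (fun t b => gm s a t b) g) f.

Definition fsstar (f : fs S A) : fs S A := lext gs f.

Record generator_laws : Prop := GeneratorLaws {
  gmDl : forall s t b, {morph (fun a => gm s a t b) : a a' / a + a'};
  gmDr : forall s a t, {morph gm s a t : b b' / b + b'};
  gmZl : forall s c a t b, gm s (c *: a) t b = c *: gm s a t b;
  gmZr : forall s a t c b, gm s a t (c *: b) = c *: gm s a t b;
  gmA : forall s a t b u c,
    lext (fun v x => gm v x u c) (gm s a t b) = lext (gm s a) (gm t b u c);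
  gsD : forall s, {morph gs s : a b / a + b};
  gsZ : forall s c a, gs s (c *: a) = sg c *: gs s a;
  gsK : forall s a, lext gs (gs s a) = delta s a;
  gsM : forall s a t b, lext gs (gm s a t b) = fsmul (gs t b) (gs s a) }.

Section Biadditive.
Hypothesis Dl : forall s t b, {morph (fun a => gm s a t b) : a a' / a + a'}.
Hypothesis Dr : forall s a t, {morph gm s a t : b b' / b + b'}.

Lemma fsmul_genD (g : fs S A) s :
  {morph (fun a => lext (fun t b => gm s a t b) g) : a a' / a + a'}.
Proof.
move=> a a' /=; elim/fs_ind: g => [|f g ef eg|t b].
- by rewrite !lext0 ?addr0.
- by rewrite !lextD ?ef ?eg 1?addrACA.
- by rewrite !lext_delta ?Dl.
Qed.

Lemma fsmulDl : left_distributive fsmul +%R.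
Proof. by move=> f f' g; rewrite /fsmul lextD //; apply: fsmul_genD. Qed.

Lemma fsmulDr : right_distributive fsmul +%R.
Proof.
move=> f g g'; elim/fs_ind: f => [|f f' ef ef'|s a].
- by rewrite /fsmul !lext0 ?addr0 //; apply: fsmul_genD.
- by rewrite !fsmulDl ef ef' addrACA.
- by rewrite /fsmul !lext_delta ?lextD //; apply: fsmul_genD.
Qed.

Lemma fsmul0r f : fsmul 0 f = 0.
Proof. by rewrite /fsmul lext0 //; apply: fsmul_genD. Qed.

Lemma fsmulr0 f : fsmul f 0 = 0.
Proof. by apply: (addrI (fsmul f 0)); rewrite -fsmulDr !addr0. Qed.

Lemma fsmul_gen s a t b : fsmul (delta s a) (delta t b) = gm s a t b.
Proof. by rewrite /fsmul lext_delta ?lext_delta //; apply: fsmul_genD. Qed.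
End Biadditive.

Hypothesis H : generator_laws.
Let Dl := gmDl H.
Let Dr := gmDr H.
Let mulDl := fsmulDl Dl Dr.
Let mulDr := fsmulDr Dl Dr.
Let mul0r := fsmul0r Dl Dr.
Let mulr0 := fsmulr0 Dl Dr.

Lemma fsmul_delta s a t b : fsmul (delta s a) (delta t b) = gm s a t b.
Proof. exact: fsmul_gen. Qed.

Lemma fsmulZl c f g : fsmul (c *: f) g = c *: fsmul f g.
Proof.
elim/fs_ind: f => [|f f' ef ef'|s a].
- by rewrite scaler0 !mul0r scaler0.
- by rewrite scalerDr !mulDl ef ef' scalerDr.
elim/fs_ind: g => [|f f' ef ef'|t b].
- by rewrite !mulr0 scaler0.
- by rewrite !mulDr ef ef' scalerDr.
- by rewrite -deltaZ !fsmul_delta gmZl.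
Qed.

Lemma fsmulZr c f g : fsmul f (c *: g) = c *: fsmul f g.
Proof.
elim/fs_ind: f => [|f f' ef ef'|s a].
- by rewrite !mul0r scaler0.
- by rewrite !mulDl ef ef' scalerDr.
elim/fs_ind: g => [|f f' ef ef'|t b].
- by rewrite scaler0 !mulr0 scaler0.
- by rewrite scalerDr !mulDr ef ef' scalerDr.
- by rewrite -deltaZ !fsmul_delta gmZr.
Qed.

Lemma fsmulA : associative fsmul.
Proof.
move=> f g h; elim/fs_ind: f => [|f f' ef ef'|s a].
- by rewrite !mul0r.
- by rewrite !mulDl ef ef'.
elim/fs_ind: g => [|f f' ef ef'|t b].
- by rewrite !(mul0r, mulr0).
- by rewrite !(mulDl, mulDr) ef ef'.
elim/fs_ind: h => [|f f' ef ef'|u c].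
- by rewrite !mulr0.
- by rewrite !mulDr ef ef'.
rewrite !fsmul_delta /fsmul lext_delta; last exact: (fsmul_genD Dl Dr).
rewrite -(gmA H); apply: eq_lext => v.
by rewrite lext_delta // => w; apply: gmDr.
Qed.

Lemma fsstarD : {morph fsstar : f g / f + g}.
Proof. by apply: lextD => s; apply: gsD. Qed.

Lemma fsstar0 : fsstar 0 = 0.
Proof. by rewrite /fsstar lext0 // => s; apply: gsD. Qed.

Lemma fsstar_delta s a : fsstar (delta s a) = gs s a.
Proof. by rewrite /fsstar lext_delta // => t; apply: gsD. Qed.

Lemma fsstarZ c f : fsstar (c *: f) = sg c *: fsstar f.
Proof. by apply: (lextZ (sg := sg)) => s; [apply: gsD | apply: gsZ]. Qed.

Lemma fsstarK : involutive fsstar.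
Proof.
elim/fs_ind => [|f f' ef ef'|s a].
- by rewrite !fsstar0.
- by rewrite !fsstarD ef ef'.
- by rewrite fsstar_delta; exact: (gsK H).
Qed.

Lemma fsstarM f g : fsstar (fsmul f g) = fsmul (fsstar g) (fsstar f).
Proof.
elim/fs_ind: f => [|f f' ef ef'|s a].
- by rewrite !(mul0r, fsstar0, mulr0).
- by rewrite !(mulDl, fsstarD, mulDr) ef ef'.
elim/fs_ind: g => [|f f' ef ef'|t b].
- by rewrite !(mul0r, fsstar0, mulr0).
- by rewrite !(mulDl, fsstarD, mulDr) ef ef'.
- by rewrite fsmul_delta !fsstar_delta; exact: (gsM H).
Qed.

Definition fs_staralg : staralg :=
  StarAlg fsmulA mulDl mulDr fsmulZl fsmulZr fsstarK fsstarD fsstarZ fsstarM.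

Lemma lext_star_hom (B : staralg) (phi : S -> A -> B) :
  (forall s, linear (phi s)) ->
  (forall s a t b, lext phi (gm s a t b) = smul (phi s a) (phi t b)) ->
  (forall s a, lext phi (gs s a) = star (phi s a)) ->
  @is_star_hom fs_staralg B (lext phi).
Proof.
move=> phiL phiM phiS.
have phiD s : {morph phi s : a b / a + b}.
  by move=> a b; have := phiL s 1 a b; rewrite !scale1r.
have phiZ s c a : phi s (c *: a) = c *: phi s a.
  have phi0 : phi s 0 = 0 by apply: (addrI (phi s 0)); rewrite -phiD !addr0.
  by have := phiL s c a 0; rewrite phi0 !addr0.
split.
- by move=> c f g; rewrite lextD // (lextZ (sg := id)).
- move=> f g; elim/fs_ind: f => [|f f' ef ef'|s a].
  + by rewrite smul0r !lext0 // smul0r.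
  + by rewrite smulDl !lextD // smulDl ef ef'.
  elim/fs_ind: g => [|f f' ef ef'|t b].
  + by rewrite smulr0 !lext0 // smulr0.
  + by rewrite smulDr !lextD // smulDr ef ef'.
  + by rewrite [smul _ _]fsmul_delta phiM !lext_delta.
- elim/fs_ind => [|f f' ef ef'|s a].
  + by rewrite star0 !lext0 // star0.
  + by rewrite starD !lextD // starD ef ef'.
  + by rewrite [star _]fsstar_delta phiS lext_delta.
Qed.

End GeneratorLaws.

Lemma delta_linear (S : choiceType) (A : lmodType l) (s : S) : linear (@delta l S A s).
Proof. by move=> c a b; rewrite deltaD deltaZ. Qed.

Section Matrices.
Variables (X : choiceType) (A : staralg).

Definition mx_gm (p : X * X) (a : A) (q : X * X) (b : A) : fs (X * X)%type A :=
  if p.2 == q.1 then delta (p.1, q.2) (smul a b) else 0.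

Definition mx_gs (p : X * X) (a : A) : fs (X * X)%type A :=
  delta (p.2, p.1) (star a).

Lemma mx_laws : generator_laws mx_gm mx_gs.
Proof.
have gmDl s t b : {morph (fun a => mx_gm s a t b) : a a' / a + a'}.
  by move=> a a'; rewrite /mx_gm; case: eqP; rewrite ?addr0 // smulDl deltaD.
have gmDr s a t : {morph mx_gm s a t : b b' / b + b'}.
  by move=> b b'; rewrite /mx_gm; case: eqP; rewrite ?addr0 // smulDr deltaD.
have gsD s : {morph mx_gs s : a b / a + b}.
  by move=> a b; rewrite /mx_gs starD deltaD.
split=> //.
- move=> s c a t b; rewrite /mx_gm; case: eqP; rewrite ?scaler0 // smulZl deltaZ //.
- move=> s a t c b; rewrite /mx_gm; case: eqP; rewrite ?scaler0 // smulZr deltaZ //.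
- move=> s a t b u c; rewrite {2 4}/mx_gm.
  case: eqP => st; case: eqP => tu; rewrite ?lext0 ?lext_delta // /mx_gm /= ?st ?tu ?eqxx ?smulA //.
    by move/eqP/negPf: tu => ->.
  by move/eqP/negPf: st => ->.
- by move=> s c a; rewrite /mx_gs starZ deltaZ.
- by move=> [x y] a; rewrite {2}/mx_gs lext_delta // /mx_gs /= starK.
- move=> s a t b; rewrite /fsmul {2 3}/mx_gs lext_delta; last first.
    by move=> v x x'; rewrite !lext_delta // gmDl.
  rewrite lext_delta //.
  rewrite /mx_gm /= [t.1 == _]eq_sym; case: eqP => st; rewrite ?lext0 //.
  by rewrite lext_delta // /mx_gs /= starM.
Qed.

End Matrices.

End StarAlgebras.

Section FsMap.
Variables (l : comPzRingType) (sg : conjugation l).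

Definition fsmap (S T : choiceType) (A B : lmodType l) (u : S -> T) (f : A -> B) :
  fs S A -> fs T B := lext (fun s a => delta (u s) (f a)).

Section Basics.
Variables (S T : choiceType) (A B : lmodType l) (u : S -> T) (f : A -> B).
Hypothesis fD : {morph f : a b / a + b}.

Lemma fsmapD : {morph fsmap u f : x y / x + y}.
Proof. by apply: lextD => s a b; rewrite fD deltaD. Qed.

Lemma fsmap0 : fsmap u f 0 = 0.
Proof. by apply: (addrI (fsmap u f 0)); rewrite -fsmapD !addr0. Qed.

Lemma fsmap_delta s a : fsmap u f (delta s a) = delta (u s) (f a).
Proof. by rewrite /fsmap lext_delta // => t b c; rewrite fD deltaD. Qed.

Lemma fsmapE (v : T -> S) (x : fs S A) t : cancel u v -> cancel v u ->
  fsmap u f x t = f (x (v t)).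
Proof.
move=> uK vK; have f0 : f 0 = 0 by apply: (addrI (f 0)); rewrite -fD !addr0.
elim/fs_ind: x => [|x y ex ey|s a].
- by rewrite fsmap0 f0.
- by rewrite fsmapD !fsDE ex ey fD.
- by rewrite fsmap_delta !deltaE (can2_eq vK uK); case: eqP.
Qed.
End Basics.

Lemma fsmap_id (S : choiceType) (A : lmodType l) (u : S -> S) (f : A -> A) x :
  u =1 id -> f =1 id -> fsmap u f x = x.
Proof.
move=> uid fid; have fD : {morph f : a b / a + b} by move=> a b; rewrite !fid.
elim/fs_ind: x => [|x y ex ey|s a].
- by rewrite fsmap0.
- by rewrite fsmapD // ex ey.
- by rewrite fsmap_delta // uid fid.
Qed.

Lemma fsmap_comp (S T U : choiceType) (A B C : lmodType l)
    (u : S -> T) (v : T -> U) (f : A -> B) (g : B -> C) x :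
  {morph f : a b / a + b} -> {morph g : a b / a + b} ->
  fsmap v g (fsmap u f x) = fsmap (v \o u) (g \o f) x.
Proof.
move=> fD gD; have gfD : {morph g \o f : a b / a + b} by move=> a b /=; rewrite fD gD.
elim/fs_ind: x => [|x y ex ey|s a].
- by rewrite !fsmap0.
- by rewrite !fsmapD // ex ey.
- by rewrite !fsmap_delta.
Qed.

Lemma eq_fsmap (S T : choiceType) (A B : lmodType l)
    (u u' : S -> T) (f f' : A -> B) :
  u =1 u' -> f =1 f' -> fsmap u f =1 fsmap u' f'.
Proof. by move=> eu ef x; apply: eq_lext => s; rewrite eu ef. Qed.

Lemma fsmap_star_hom (S T : choiceType) (A B : staralg sg)
    (gm : S -> A -> S -> A -> fs S A) (gs : S -> A -> fs S A)
    (gm' : T -> B -> T -> B -> fs T B) (gs' : T -> B -> fs T B)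
    (H : generator_laws sg gm gs) (H' : generator_laws sg gm' gs')
    (u : S -> T) (f : A -> B) : linear f ->
  (forall s a t b, fsmap u f (gm s a t b) = gm' (u s) (f a) (u t) (f b)) ->
  (forall s a, fsmap u f (gs s a) = gs' (u s) (f a)) ->
  @is_star_hom l sg (fs_staralg H) (fs_staralg H') (fsmap u f).
Proof.
move=> fL fM fS; apply: lext_star_hom => [s c a b|s a t b|s a].
- by rewrite fL deltaD deltaZ.
- by rewrite [RHS](fsmul_delta H') -fM.
- by rewrite [RHS](fsstar_delta H') -fS.
Qed.

End FsMap.

Section MorePlainAlgebras.
Variables (l : comPzRingType) (sg : conjugation l).

Definition mx_staralg (X : choiceType) (A : staralg sg) : staralg sg :=
  fs_staralg (mx_laws X A).

Section Pm.
Variable A : staralg sg.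

(* With h = diag(1, -1), where [false] is the first index, the (i, j) entry of
   h * x^* * h is h_i * h_j times the (i, j) entry of x^*. *)
Definition pm_gs (p : bool * bool) (a : A) : fs (bool * bool)%type A :=
  delta (p.2, p.1) (((-1) ^+ p.2 * (-1) ^+ p.1) *: star a).

Lemma pm_laws : generator_laws sg (@mx_gm l sg bool A) pm_gs.
Proof.
have [Dl Dr Zl Zr As _ _ _ _] := mx_laws bool A.
have gsD s : {morph pm_gs s : a b / a + b}.
  by move=> a b; rewrite /pm_gs starD scalerDr deltaD.
have sgh (i j : bool) : sg ((-1) ^+ i * (-1) ^+ j) = (-1) ^+ i * (-1) ^+ j.
  by rewrite rmorphM !rmorphXn !rmorphN1.
split=> //.
- by move=> s c a; rewrite /pm_gs starZ -deltaZ !scalerA mulrC.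
- move=> [x y] a; rewrite {2}/pm_gs lext_delta // /pm_gs /= starZ starK sgh.
  rewrite scalerA; case: x; case: y; rewrite ?expr0 ?expr1 !(mulrNN, mulr1, mul1r, scale1r) //.
- move=> s a t b; rewrite /fsmul {2 3}/pm_gs lext_delta; last first.
    by move=> v x x'; rewrite !lext_delta // Dl.
  rewrite lext_delta //.
  rewrite /mx_gm /= [t.1 == _]eq_sym; case: eqP => st; rewrite ?lext0 //.
  rewrite lext_delta // /pm_gs /= starM smulZl smulZr scalerA st.
  congr (delta _ (_ *: _)); move: (s.1) (t.1) (t.2) => i j k.
  by case: i; case: j; case: k; rewrite ?expr0 ?expr1 !(mulrNN, mulr1, mul1r).
Qed.

Definition pm_staralg : staralg sg := fs_staralg pm_laws.
End Pm.

Section Polynomials.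
Variable A : staralg sg.

(* [delta n a] is the monomial a t^n. *)
Definition pl_gm (m : nat) (a : A) (n : nat) (b : A) : fs nat A :=
  delta (m + n)%N (smul a b).

Definition pl_gs (n : nat) (a : A) : fs nat A := delta n (star a).

Lemma pl_laws : generator_laws sg pl_gm pl_gs.
Proof.
have gmDl s t b : {morph (fun a => pl_gm s a t b) : a a' / a + a'}.
  by move=> a a'; rewrite /pl_gm smulDl deltaD.
have gmDr s a t : {morph pl_gm s a t : b b' / b + b'}.
  by move=> b b'; rewrite /pl_gm smulDr deltaD.
have gsD s : {morph pl_gs s : a b / a + b}.
  by move=> a b; rewrite /pl_gs starD deltaD.
split=> //.
- by move=> s c a t b; rewrite /pl_gm smulZl deltaZ.
- by move=> s a t c b; rewrite /pl_gm smulZr deltaZ.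
- by move=> s a t b u c; rewrite {2 4}/pl_gm !lext_delta // /pl_gm addnA smulA.
- by move=> s c a; rewrite /pl_gs starZ deltaZ.
- by move=> s a; rewrite {2}/pl_gs lext_delta // /pl_gs starK.
- move=> s a t b; rewrite /fsmul {2 3}/pl_gs lext_delta; last first.
    by move=> v x x'; rewrite !lext_delta // gmDl.
  by rewrite !lext_delta // /pl_gs /pl_gm starM addnC.
Qed.

Definition pl_staralg : staralg sg := fs_staralg pl_laws.
End Polynomials.
End MorePlainAlgebras.

Section Equivariant.
Variables (l : comPzRingType) (sg : conjugation l) (G : groupType).

Record galg := GAlg {
  galg_alg :> staralg sg;
  gact : G -> galg_alg -> galg_alg;
  gact_hom : forall g, is_star_hom (gact g);
  gact1 : forall a, gact 1%g a = a;
  gactM : forall g h a, gact (g * h)%g a = gact g (gact h a) }.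

Record galg_hom (A B : galg) := GAlgHom {
  galg_fun :> A -> B;
  galg_funP : is_star_hom galg_fun;
  galg_fun_act : forall g a, galg_fun (gact g a) = gact g (galg_fun a) }.

Lemma galg_hom_eq (A B : galg) (f h : galg_hom A B) : f =1 h -> f = h.
Proof.
case: f h => [f f1 f2] [h h1 h2] /= /funext e; subst h.
by rewrite (Prop_irrelevance f1 h1) (Prop_irrelevance f2 h2).
Qed.

Definition galg_id (A : galg) : galg_hom A A :=
  @GAlgHom A A id (star_hom_id A) (fun _ _ => erefl).

Lemma galg_comp_act (A B C : galg) (h : galg_hom B C) (f : galg_hom A B) g a :
  (h \o f) (gact g a) = gact g ((h \o f) a).
Proof. by rewrite /= !galg_fun_act. Qed.

Definition galg_comp (A B C : galg) (h : galg_hom B C) (f : galg_hom A B) :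
  galg_hom A C :=
  GAlgHom (star_hom_comp (galg_funP h) (galg_funP f)) (galg_comp_act h f).

Record gset := GSet {
  gset_car :> choiceType;
  gsact : G -> gset_car -> gset_car;
  gsact1 : forall x, gsact 1%g x = x;
  gsactM : forall g h x, gsact (g * h)%g x = gsact g (gsact h x) }.

Definition triv_gset (X : choiceType) : gset :=
  @GSet X (fun _ x => x) (fun _ => erefl) (fun _ _ _ => erefl).

Definition sum_gsact (X Y : gset) (g : G) (z : X + Y) : X + Y :=
  match z with inl x => inl (gsact g x) | inr y => inr (gsact g y) end.

Lemma sum_gsact1 (X Y : gset) (z : X + Y) : sum_gsact 1%g z = z.
Proof. by case: z => z /=; rewrite gsact1. Qed.

Lemma sum_gsactM (X Y : gset) g h (z : X + Y) :
  sum_gsact (g * h)%g z = sum_gsact g (sum_gsact h z).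
Proof. by case: z => z /=; rewrite gsactM. Qed.

Definition sum_gset (X Y : gset) : gset :=
  @GSet (X + Y)%type (@sum_gsact X Y) (@sum_gsact1 X Y) (@sum_gsactM X Y).

Lemma gactD (A : galg) g : {morph (@gact A g) : a b / a + b}.
Proof. exact: shD (gact_hom A g). Qed.

Section GMatrices.
Variables (X : gset) (A : galg).

Definition gmx_act (g : G) : mx_staralg X A -> mx_staralg X A :=
  fsmap (fun p : X * X => (gsact g p.1, gsact g p.2)) (gact g).

Lemma gmx_actE g (f : mx_staralg X A) x y :
  (gmx_act g f : fs (X * X)%type A) (x, y) =
  gact g ((f : fs (X * X)%type A) (gsact g^-1 x, gsact g^-1 y)).
Proof.
rewrite [LHS](@fsmapE l _ _ _ _ _ _ (@gactD A g)
  (fun p => (gsact g^-1 p.1, gsact g^-1 p.2))) //.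
- by case=> u v /=; rewrite -!gsactM mulVg !gsact1.
- by case=> u v /=; rewrite -!gsactM mulgV !gsact1.
Qed.

Lemma gsact_inj g : injective (@gsact X g).
Proof. by apply: (can_inj (g := gsact g^-1)) => x; rewrite -gsactM mulVg gsact1. Qed.

Lemma gmx_act_hom g : is_star_hom (gmx_act g).
Proof.
have hg := gact_hom A g; apply: fsmap_star_hom => [||s a].
- exact: shL hg.
- move=> s a t b; rewrite /mx_gm /= (inj_eq (@gsact_inj g)).
  by case: eqP => _; rewrite ?fsmap_delta ?fsmap0 ?(shM hg) //; exact: gactD.
- by rewrite /mx_gs fsmap_delta ?(shS hg) //; exact: gactD.
Qed.

Lemma gmx_act1 f : gmx_act 1%g f = f.
Proof.
by apply: fsmap_id => [[x y]|a] /=; rewrite ?gsact1 ?gact1.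
Qed.

Lemma gmx_actM g h f : gmx_act (g * h)%g f = gmx_act g (gmx_act h f).
Proof.
rewrite /gmx_act fsmap_comp; try exact: gactD.
by apply: eq_fsmap => [[x y]|a] /=; rewrite ?gsactM ?gactM.
Qed.

Definition gmx : galg := GAlg gmx_act_hom gmx_act1 gmx_actM.

End GMatrices.

Section CoeffAction.
Variables (A : galg).

Definition gpm_act (g : G) : pm_staralg A -> pm_staralg A := fsmap id (gact g).

Lemma gpm_act_hom g : is_star_hom (gpm_act g).
Proof.
have hg := gact_hom A g; apply: fsmap_star_hom => [||s a].
- exact: shL hg.
- move=> s a t b; rewrite /mx_gm.
  by case: eqP => _; rewrite ?fsmap_delta ?fsmap0 ?(shM hg) //; exact: gactD.
- by rewrite /pm_gs fsmap_delta ?(shZ hg) ?(shS hg) //; exact: gactD.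
Qed.

Lemma gpm_act1 f : gpm_act 1%g f = f.
Proof. by apply: fsmap_id => // a; rewrite gact1. Qed.

Lemma gpm_actM g h f : gpm_act (g * h)%g f = gpm_act g (gpm_act h f).
Proof.
rewrite /gpm_act fsmap_comp; try exact: gactD.
by apply: eq_fsmap => // a; rewrite gactM.
Qed.

Definition gpm : galg := GAlg gpm_act_hom gpm_act1 gpm_actM.

Definition gpl_act (g : G) : pl_staralg A -> pl_staralg A := fsmap id (gact g).

Lemma gpl_act_hom g : is_star_hom (gpl_act g).
Proof.
have hg := gact_hom A g; apply: fsmap_star_hom => [||s a].
- exact: shL hg.
- by move=> s a t b; rewrite /pl_gm fsmap_delta ?(shM hg) //; exact: gactD.
- by rewrite /pl_gs fsmap_delta ?(shS hg) //; exact: gactD.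
Qed.

Lemma gpl_act1 f : gpl_act 1%g f = f.
Proof. by apply: fsmap_id => // a; rewrite gact1. Qed.

Lemma gpl_actM g h f : gpl_act (g * h)%g f = gpl_act g (gpl_act h f).
Proof.
rewrite /gpl_act fsmap_comp; try exact: gactD.
by apply: eq_fsmap => // a; rewrite gactM.
Qed.

Definition gpl : galg := GAlg gpl_act_hom gpl_act1 gpl_actM.
End CoeffAction.
End Equivariant.

Section PlainCorners.
Variables (l : comPzRingType) (sg : conjugation l) (A : staralg sg).

Lemma mx_corner_hom (X : choiceType) (x : X) :
  @is_star_hom l sg A (mx_staralg X A) (delta (x, x)).
Proof.
split=> [|a b|a]; first exact: delta_linear.
- by rewrite [RHS](fsmul_delta (mx_laws X A)) /mx_gm eqxx.
- by rewrite [RHS](fsstar_delta (mx_laws X A)).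
Qed.

Lemma pm_corner_hom : @is_star_hom l sg A (pm_staralg A) (delta (false, false)).
Proof.
split=> [|a b|a]; first exact: delta_linear.
- by rewrite [RHS](fsmul_delta (pm_laws A)) /mx_gm eqxx.
- by rewrite [RHS](fsstar_delta (pm_laws A)) /pm_gs expr0 mulr1 scale1r.
Qed.

Lemma pl_const_hom : @is_star_hom l sg A (pl_staralg A) (delta 0%N).
Proof.
split=> [|a b|a]; first exact: delta_linear.
- by rewrite [RHS](fsmul_delta (pl_laws A)).
- by rewrite [RHS](fsstar_delta (pl_laws A)).
Qed.

Definition mx_inl (X Y : choiceType) : mx_staralg X A -> mx_staralg (X + Y)%type A :=
  fsmap (fun p : X * X => (inl p.1, inl p.2)) id.

Lemma mx_inl_hom (X Y : choiceType) : is_star_hom (@mx_inl X Y).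
Proof.
apply: fsmap_star_hom => // [s a t b|s a]; rewrite ?/mx_gs ?fsmap_delta //.
rewrite /mx_gm /= (inj_eq (@inl_inj _ _)).
by case: eqP => _; rewrite ?fsmap_delta ?fsmap0.
Qed.

End PlainCorners.

Section EquivariantCorners.
Variables (l : comPzRingType) (sg : conjugation l) (G : groupType) (A : galg sg G).

Lemma gmx_corner_act (X : choiceType) (x : X) g a :
  delta (x, x) (gact g a) = gact g (delta (x, x) a : gmx (triv_gset G X) A).
Proof. by rewrite [RHS]fsmap_delta //; apply: gactD. Qed.

Definition gmx_corner (X : choiceType) (x : X) : galg_hom A (gmx (triv_gset G X) A) :=
  @GAlgHom l sg G A (gmx (triv_gset G X) A) _ (mx_corner_hom A x) (gmx_corner_act x).

Lemma gpm_corner_act g a :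
  delta (false, false) (gact g a) = gact g (delta (false, false) a : gpm A).
Proof. by rewrite [RHS]fsmap_delta //; apply: gactD. Qed.

Definition gpm_corner : galg_hom A (gpm A) :=
  @GAlgHom l sg G A (gpm A) _ (pm_corner_hom A) gpm_corner_act.

Lemma gpl_const_act g a : delta 0%N (gact g a) = gact g (delta 0%N a : gpl A).
Proof. by rewrite [RHS]fsmap_delta //; apply: gactD. Qed.

Definition gpl_const : galg_hom A (gpl A) :=
  @GAlgHom l sg G A (gpl A) _ (pl_const_hom A) gpl_const_act.

Lemma gmx_inl_act (X Y : gset G) g a :
  @mx_inl l sg A X Y (gact g (a : gmx X A)) =
  gact g (mx_inl Y (a : gmx X A) : gmx (sum_gset X Y) A).
Proof.
rewrite [LHS]fsmap_comp; [|exact: gactD|by []].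
by rewrite [RHS]fsmap_comp //; exact: gactD.
Qed.

Definition gmx_inl (X Y : gset G) : galg_hom (gmx X A) (gmx (sum_gset X Y) A) :=
  @GAlgHom l sg G (gmx X A) (gmx (sum_gset X Y) A) _ (mx_inl_hom A X Y)
    (@gmx_inl_act X Y).
End EquivariantCorners.

Section DirectSum.
Variables (l : comPzRingType) (I : choiceType) (A : lmodType l).

(* [D] is a family of submodules of which A is the internal direct sum. *)
Record direct_sum (D : I -> set A) : Prop := DirectSum {
  ds0 : forall i, D i 0;
  dsL : forall i c a b, D i a -> D i b -> D i (c *: a + b);
  ds_dec : forall a, exists! f : fs I A,
    (forall i, D i (f i)) /\ a = \sum_(i \in [set: I]) f i }.

Lemma direct_sum_intro (D : I -> set A) (p : A -> fs I A) :
  (forall i, D i 0) ->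
  (forall i c a b, D i a -> D i b -> D i (c *: a + b)) ->
  {morph p : a b / a + b} ->
  (forall a i, D i (p a i)) ->
  (forall i a, D i a -> p a = delta i a) ->
  (forall a, \sum_(i \in [set: I]) p a i = a) ->
  direct_sum D.
Proof.
move=> D0 DL pD Dp pd ps; split=> // a; exists (p a); split=> [//|f [Df ->]].
rewrite -/(lext (fun _ => id) f) lext_comp //.
transitivity (lext (fun i => @delta l I A i) f).
  by apply: eq_lext => i; apply: pd.
elim/fs_ind: f {Df} => [|f g ef eg|s b].
- by rewrite lext0 // => i; apply: deltaD.
- by rewrite lextD ?ef ?eg // => i; apply: deltaD.
- by rewrite lext_delta // => i; apply: deltaD.
Qed.

Section Decomposition.
Variables (D : I -> set A) (H : direct_sum D).

(* [dec a i] is the component of a in D i. *)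
Definition dec (a : A) : fs I A := projT1 (cid (ds_dec H a)).

Lemma dec_in (a : A) i : D i (dec a i).
Proof. by rewrite /dec; case: cid => f /= [[Df _] _]. Qed.

Lemma dec_sum a : lext (fun _ => id) (dec a) = a.
Proof. by rewrite /dec; case: cid => f /= [[_ ->] _]. Qed.

Lemma dec_uniq (a : A) (f : fs I A) : (forall i, D i (f i)) -> a = lext (fun _ => id) f -> dec a = f.
Proof. by rewrite /dec; case: cid => h /= [_ u] Df af; apply: u. Qed.

Lemma dsD i a b : D i a -> D i b -> D i (a + b).
Proof. by move=> Da Db; rewrite -[a]scale1r; apply: (dsL H). Qed.

Lemma dsZ i c a : D i a -> D i (c *: a).
Proof. by move=> Da; rewrite -[_ *: _]addr0; apply: (dsL H) => //; apply: (ds0 H). Qed.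

Lemma dec_hom i a : D i a -> dec a = delta i a.
Proof.
move=> Da; apply: dec_uniq => [j|]; last by rewrite lext_delta.
by rewrite deltaE; case: eqP => [->|_] //; apply: (ds0 H).
Qed.

Lemma decD : {morph dec : a b / a + b}.
Proof.
move=> a b; apply: dec_uniq => [i|]; last by rewrite lextD // !dec_sum.
by apply: dsD; apply: dec_in.
Qed.

Lemma decZ c a : dec (c *: a) = c *: dec a.
Proof.
apply: dec_uniq => [i|]; first by apply: dsZ; apply: dec_in.
by rewrite (lextZ (sg := id)) // dec_sum.
Qed.

Lemma dec_ind (P : A -> Prop) : P 0 -> (forall a b, P a -> P b -> P (a + b)) ->
  (forall i a, D i a -> P a) -> forall a, P a.
Proof.
move=> P0 PD Ph a; rewrite -(dec_sum a); apply: lext_closed => // i.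
by apply: Ph (dec_in a i).
Qed.

Lemma ds_disjoint i j a : D i a -> D j a -> i != j -> a = 0.
Proof.
move=> Di Dj /negPf ij; have e : delta i a = delta j a.
  by rewrite -(dec_hom Di) -(dec_hom Dj).
have := congr1 (fun f : fs I A => f i) e.
by rewrite !deltaE eqxx ij.
Qed.

End Decomposition.
End DirectSum.

Lemma fs_direct_sum (l : comPzRingType) (I S : choiceType) (A : lmodType l)
    (D : I -> S -> set A) : (forall s, direct_sum (D^~ s)) ->
  direct_sum (fun i => [set f : fs S A | forall s, D i s (f s)]).
Proof.
move=> H.
pose q s a : fs I (fs S A) := lext (fun i b => delta i (delta s b)) (dec (H s) a).
have dd s (i : I) : {morph (fun b : A => delta i (delta s b : fs S A)) : a b / a + b}.
  by move=> a b; rewrite !deltaD.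
have qD s : {morph q s : a b / a + b}.
  by move=> a b; rewrite /q decD (lextD (dd s)).
have qE s a i t : q s a i t = if t == s then dec (H s) a i else 0.
  rewrite /q; elim/fs_ind: (dec _ _) => [|f g ef eg|j b].
  - by rewrite (lext0 (dd s)); case: eqP.
  - by rewrite (lextD (dd s)) !fsDE ef eg; case: eqP; rewrite ?addr0.
  - by rewrite (lext_delta (dd s)) !deltaE (fun_if (fun h : fs S A => h t)) deltaE; case: eqP; case: eqP.
pose p (f : fs S A) := lext q f.
have pE f i s : p f i s = dec (H s) (f s) i.
  elim/fs_ind: f => [|f g ef eg|t a].
  - rewrite /p (lext0 qD) (dec_hom (H s) (i := i)) //; last exact: (ds0 (H s)).
    by rewrite delta0.
  - by rewrite /p (lextD qD) !fsDE ef eg decD.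
  - rewrite /p (lext_delta qD) qE deltaE; case: eqP => [->|_] //.
    by rewrite (dec_hom (H s) (i := i)) ?delta0 //; exact: (ds0 (H s)).
apply: (@direct_sum_intro _ _ _ _ p).
- by move=> i s; apply: (ds0 (H s)).
- by move=> i c f g Df Dg s; apply: (dsL (H s)).
- exact: (lextD qD).
- by move=> f i s; rewrite pE; exact: (dec_in (H s) (f s) i).
- move=> i f Df; apply: fs_eqP => j; apply: fs_eqP => s.
  rewrite pE (dec_hom (H s) (Df s)) !deltaE (fun_if (fun h : fs S A => h s)).
  by case: eqP.
- have sD : {morph lext (fun _ : I => @id (fs S A)) : x y / x + y} by exact: lextD.
  move=> f; rewrite -/(lext (fun _ => id) (p f)) (lext_comp _ qD sD).
  transitivity (lext (fun s => @delta l S A s) f).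
    apply: eq_lext => s; rewrite /q (lext_comp _ (dd s) sD).
    rewrite -[in RHS](dec_sum (H s) (f s)) [RHS]lext_comp //; last exact: deltaD.
    by apply: eq_lext => i; rewrite lext_delta.
  elim/fs_ind: f => [|f g ef eg|s b].
  + by rewrite lext0 // => i; apply: deltaD.
  + by rewrite lextD ?ef ?eg // => i; apply: deltaD.
  + by rewrite lext_delta // => i; apply: deltaD.
Qed.

Section Graded.
Variables (l : comPzRingType) (sg : conjugation l) (G : groupType).

Record gralg := GrAlg {
  gralg_alg :> staralg sg;
  gdeg : G -> set gralg_alg;
  gdeg_sum : direct_sum gdeg;
  gdegM : forall g h a b, gdeg g a -> gdeg h b -> gdeg (g * h)%g (smul a b);
  gdegS : forall g a, gdeg g a -> gdeg g^-1%g (star a) }.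

Record gralg_hom (A B : gralg) := GrAlgHom {
  gralg_fun :> A -> B;
  gralg_funP : is_star_hom gralg_fun;
  gralg_fun_deg : forall g a, gdeg g a -> gdeg g (gralg_fun a) }.

Lemma gralg_hom_eq (A B : gralg) (f h : gralg_hom A B) : f =1 h -> f = h.
Proof.
case: f h => [f f1 f2] [h h1 h2] /= /funext e; subst h.
by rewrite (Prop_irrelevance f1 h1) (Prop_irrelevance f2 h2).
Qed.

Definition gralg_id (A : gralg) : gralg_hom A A :=
  @GrAlgHom A A id (star_hom_id A) (fun _ _ H => H).

Definition gralg_comp (A B C : gralg) (h : gralg_hom B C) (f : gralg_hom A B) :
  gralg_hom A C :=
  GrAlgHom (star_hom_comp (gralg_funP h) (gralg_funP f))
    (fun g a H => gralg_fun_deg h (gralg_fun_deg f H)).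

Record grset := GrSet { grset_car :> choiceType; grset_deg : grset_car -> G }.

Definition triv_grset (X : choiceType) : grset := @GrSet X (fun _ => 1%g).

Definition sum_grset (X Y : grset) : grset :=
  @GrSet (X + Y)%type
    (fun z => match z with inl x => grset_deg x | inr y => grset_deg y end).

(* The grading of [fs S A] whose degree g elements take at s a value in D g s. *)
Section FsGrading.
Variables (S : choiceType) (A : staralg sg).
Variables (gm : S -> A -> S -> A -> fs S A) (gs : S -> A -> fs S A).
Hypothesis H : generator_laws sg gm gs.
Variable D : G -> S -> set A.

Definition fs_deg (g : G) : set (fs_staralg H) :=
  [set f | forall s, D g s ((f : fs S A) s)].

Hypothesis Dsum : forall s, direct_sum (D^~ s).

Lemma fs_deg_sum : direct_sum fs_deg.
Proof. exact: fs_direct_sum. Qed.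

Lemma fs_deg_delta g s a : D g s a -> fs_deg g (delta s a).
Proof.
by move=> Da t; rewrite deltaE; case: eqP => [->|_] //; exact: (ds0 (Dsum t) g).
Qed.

Let fs_deg0 g : fs_deg g 0.
Proof. exact: (ds0 fs_deg_sum). Qed.

Lemma fs_degM :
  (forall g h s t a b, D g s a -> D h t b -> fs_deg (g * h)%g (gm s a t b)) ->
  forall g h a b, fs_deg g a -> fs_deg h b -> fs_deg (g * h)%g (smul a b).
Proof.
move=> DM g h a b Da Db; have DD := dsD fs_deg_sum.
apply: (lext_closed (fsmul_genD (gmDl H) (gmDr H) b) (fs_deg0 _)) => [u v|s]; first exact: DD.
apply: (lext_closed (gmDr H s _) (fs_deg0 _)) => [u v|t]; first exact: DD.
exact: DM.
Qed.

Lemma fs_degS :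
  (forall g s a, D g s a -> fs_deg g^-1%g (gs s a)) ->
  forall g a, fs_deg g a -> fs_deg g^-1%g (star a).
Proof.
move=> DS g a Da; have DD := dsD fs_deg_sum.
apply: (lext_closed (gsD H) (fs_deg0 _)) => [u v|s]; first exact: DD.
exact: DS.
Qed.

End FsGrading.

Section GradedMatrices.
Variables (X : grset) (A : gralg).

(* |x| k |y|^-1 = g if and only if k = |x|^-1 g |y|. *)
Definition grmx_coef (g : G) (p : X * X) : set A :=
  gdeg ((grset_deg p.1)^-1 * g * grset_deg p.2)%g.

Lemma direct_sum_reindex (I J : choiceType) (B : lmodType l) (D : I -> set B)
  (u : J -> I) (v : I -> J) : cancel u v -> cancel v u ->
  direct_sum D -> direct_sum (fun j => D (u j)).
Proof.
move=> uK vK DS; have idD : {morph (@id B) : a b / a + b} by [].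
apply: (@direct_sum_intro _ _ _ _ (fun a => fsmap v id (dec DS a))).
- by move=> j; exact: (ds0 DS).
- by move=> j c a b; exact: (dsL DS).
- by move=> a b; rewrite decD fsmapD.
- by move=> a j; rewrite (fsmapE idD _ _ vK uK); exact: dec_in.
- by move=> j a Da; rewrite (dec_hom DS Da) fsmap_delta // uK.
- move=> a; rewrite -[RHS](dec_sum DS a); rewrite -/(lext (fun _ => id) (fsmap v id (dec DS a))).
  rewrite lext_comp //; last by move=> x y; rewrite lextD.
    by apply: eq_lext => i; rewrite lext_delta.
  by move=> i; exact: deltaD.
Qed.

Lemma grmx_coef_sum p : direct_sum (grmx_coef^~ p).
Proof.
apply: (@direct_sum_reindex _ _ _ (@gdeg A)
  (fun g => ((grset_deg p.1)^-1 * g * grset_deg p.2)%g)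
  (fun g => (grset_deg p.1 * g * (grset_deg p.2)^-1)%g)); last exact: gdeg_sum.
- by move=> g; rewrite !mulgA mulgV mul1g mulgK.
- by move=> g; rewrite !mulgA mulVg mul1g mulgVK.
Qed.

Definition grmx_deg : G -> set (mx_staralg X A) := fs_deg grmx_coef.

Lemma grmx_deg_delta g x y a : gdeg g a ->
  grmx_deg (grset_deg x * g * (grset_deg y)^-1)%g (delta (x, y) a).
Proof.
move=> Da; apply: fs_deg_delta; first exact: grmx_coef_sum.
by rewrite /grmx_coef /= !mulgA mulVg mul1g mulgVK.
Qed.

Lemma grmx_degM g h a b :
  grmx_deg g a -> grmx_deg h b -> grmx_deg (g * h)%g (smul a b).
Proof.
apply: fs_degM => [|{}g {}h [x y] [z w] {}a {}b]; first exact: grmx_coef_sum.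
rewrite /grmx_coef /mx_gm /=; case: eqP => [<-|_] Da Db; last first.
  by exact: (ds0 (fs_deg_sum _ grmx_coef_sum)).
have := grmx_deg_delta x w (gdegM Da Db).
by rewrite !mulgA mulgV mul1g mulgK mulgK.
Qed.

Lemma grmx_degS g a : grmx_deg g a -> grmx_deg g^-1%g (star a).
Proof.
apply: fs_degS => [|{}g [x y] {}a Da]; first exact: grmx_coef_sum.
have := grmx_deg_delta y x (gdegS Da).
by rewrite /= !invgM invgK !mulgA mulgV mul1g mulgK.
Qed.

Definition grmx : gralg :=
  GrAlg (fs_deg_sum _ grmx_coef_sum) grmx_degM grmx_degS.
End GradedMatrices.

Section CoeffGrading.
Variable A : gralg.

Definition grpm_deg : G -> set (pm_staralg A) := fs_deg (fun g _ => @gdeg A g).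

Lemma grpm_degM g h a b :
  grpm_deg g a -> grpm_deg h b -> grpm_deg (g * h)%g (smul a b).
Proof.
apply: fs_degM => [_|{}g {}h s t {}a {}b Da Db]; first exact: gdeg_sum.
rewrite /mx_gm; case: eqP => _; last by move=> p; exact: (ds0 (gdeg_sum A)).
by apply: fs_deg_delta => [_|]; [exact: gdeg_sum | exact: gdegM].
Qed.

Lemma grpm_degS g a : grpm_deg g a -> grpm_deg g^-1%g (star a).
Proof.
apply: fs_degS => [_|{}g s {}a Da]; first exact: gdeg_sum.
apply: fs_deg_delta => [_|]; first exact: gdeg_sum.
by apply: (dsZ (gdeg_sum A)); exact: gdegS.
Qed.

Definition grpm : gralg :=
  GrAlg (fs_deg_sum _ (fun _ => gdeg_sum A)) grpm_degM grpm_degS.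

Definition grpl_deg : G -> set (pl_staralg A) := fs_deg (fun g _ => @gdeg A g).

Lemma grpl_degM g h a b :
  grpl_deg g a -> grpl_deg h b -> grpl_deg (g * h)%g (smul a b).
Proof.
apply: fs_degM => [_|{}g {}h s t {}a {}b Da Db]; first exact: gdeg_sum.
by apply: fs_deg_delta => [_|]; [exact: gdeg_sum | exact: gdegM].
Qed.

Lemma grpl_degS g a : grpl_deg g a -> grpl_deg g^-1%g (star a).
Proof.
apply: fs_degS => [_|{}g s {}a Da]; first exact: gdeg_sum.
by apply: fs_deg_delta => [_|]; [exact: gdeg_sum | exact: gdegS].
Qed.

Definition grpl : gralg :=
  GrAlg (fs_deg_sum _ (fun _ => gdeg_sum A)) grpl_degM grpl_degS.
End CoeffGrading.

Section GradedCorners.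
Variable A : gralg.

Lemma grmx_corner_deg (X : choiceType) (x : X) g a : gdeg g a ->
  gdeg g (delta (x, x) a : grmx (triv_grset X) A).
Proof.
by move=> /(@grmx_deg_delta (triv_grset X) A g x x); rewrite /= invg1 mul1g mulg1.
Qed.

Definition grmx_corner (X : choiceType) (x : X) : gralg_hom A (grmx (triv_grset X) A) :=
  @GrAlgHom A (grmx (triv_grset X) A) _ (mx_corner_hom A x) (grmx_corner_deg x).

Lemma grpm_corner_deg g a : gdeg g a -> gdeg g (delta (false, false) a : grpm A).
Proof. by apply: fs_deg_delta => _; exact: gdeg_sum. Qed.

Definition grpm_corner : gralg_hom A (grpm A) :=
  @GrAlgHom A (grpm A) _ (pm_corner_hom A) grpm_corner_deg.

Lemma grpl_const_deg g a : gdeg g a -> gdeg g (delta 0%N a : grpl A).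
Proof. by apply: fs_deg_delta => _; exact: gdeg_sum. Qed.

Definition grpl_const : gralg_hom A (grpl A) :=
  @GrAlgHom A (grpl A) _ (pl_const_hom A) grpl_const_deg.

Lemma grmx_inl_deg (X Y : grset) g (a : grmx X A) : gdeg g a ->
  gdeg g (mx_inl Y a : grmx (sum_grset X Y) A).
Proof.
move=> Da; have DS := gdeg_sum (grmx (sum_grset X Y) A).
apply: (@lext_closed _ _ _ _ _ _ (@gdeg (grmx (sum_grset X Y) A) g)).
- by move=> s b c; rewrite deltaD.
- exact: (ds0 DS).
- by move=> u v; exact: (dsD DS).
- by move=> s; apply: fs_deg_delta; [exact: grmx_coef_sum | exact: Da].
Qed.

Definition grmx_inl (X Y : grset) : gralg_hom (grmx X A) (grmx (sum_grset X Y) A) :=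
  @GrAlgHom (grmx X A) (grmx (sum_grset X Y) A) _ (mx_inl_hom A X Y)
    (@grmx_inl_deg X Y).
End GradedCorners.

End Graded.

(* [delta g a] is the element usually written a x| g. *)
Section CrossedProduct.
Variables (l : comPzRingType) (sg : conjugation l) (G : groupType).

Section Objects.
Variable A : galg sg G.

Definition cp_gm (g : G) (a : A) (h : G) (b : A) : fs G A :=
  delta (g * h)%g (smul a (gact g b)).

Definition cp_gs (g : G) (a : A) : fs G A := delta g^-1%g (gact g^-1%g (star a)).

Lemma cp_laws : generator_laws sg cp_gm cp_gs.
Proof.
have aD g := @gactD _ _ _ A g; have hA g := gact_hom A g.
have gmDl s t b : {morph (fun a => cp_gm s a t b) : a a' / a + a'}.
  by move=> a a'; rewrite /cp_gm smulDl deltaD.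
have gmDr s a t : {morph cp_gm s a t : b b' / b + b'}.
  by move=> b b'; rewrite /cp_gm aD smulDr deltaD.
have gsD s : {morph cp_gs s : a b / a + b}.
  by move=> a b; rewrite /cp_gs starD aD deltaD.
split=> //.
- by move=> s c a t b; rewrite /cp_gm smulZl deltaZ.
- by move=> s a t c b; rewrite /cp_gm (shZ (hA _)) smulZr deltaZ.
- move=> s a t b u c; rewrite {2 4}/cp_gm !lext_delta // /cp_gm.
  by rewrite mulgA gactM (shM (hA _)) smulA.
- by move=> s c a; rewrite /cp_gs starZ (shZ (hA _)) deltaZ.
- move=> s a; rewrite {2}/cp_gs lext_delta // /cp_gs.
  by rewrite !(shS (hA _)) starK -gactM invgK mulgV gact1.
- move=> s a t b; rewrite /fsmul {2 3}/cp_gs [RHS]lext_delta; last first.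
    by move=> v x x'; rewrite !lext_delta // gmDl.
  rewrite !lext_delta // /cp_gs /cp_gm starM (shM (hA _)) invgM -gactM.
  by rewrite !(shS (hA _)) -!gactM mulgVK.
Qed.

Definition cp_deg (g : G) : set (fs_staralg cp_laws) :=
  [set f | exists a : A, f = delta g a].

Lemma cp_deg_sum : direct_sum cp_deg.
Proof.
pose q g (a : A) : fs G (fs G A) := delta g (delta g a).
have qD g : {morph q g : a b / a + b} by move=> a b; rewrite /q !deltaD.
have qE f g : lext q f g = delta g (f g).
  elim/fs_ind: f => [|f f' ef ef'|h a].
  - by rewrite (lext0 qD) delta0.
  - by rewrite (lextD qD) !fsDE ef ef' deltaD.
  - by rewrite (lext_delta qD) /q !deltaE; case: eqP => [->|]; rewrite ?delta0.
apply: (@direct_sum_intro _ _ _ _ (lext q)).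
- by move=> g; exists 0; rewrite delta0.
- by move=> g c f f' [a ->] [b ->]; exists (c *: a + b); rewrite deltaD deltaZ.
- exact: (lextD qD).
- by move=> f g; exists (f g); rewrite qE.
- by move=> g f [a ->]; rewrite (lext_delta qD).
- move=> f; rewrite -/(lext (fun _ => id) (lext q f)).
  elim/fs_ind: f => [|f f' ef ef'|h a].
  + by rewrite (lext0 qD) lext0.
  + by rewrite (lextD qD) lextD // ef ef'.
  + by rewrite (lext_delta qD) lext_delta.
Qed.

Lemma cp_degM g h a b : cp_deg g a -> cp_deg h b -> cp_deg (g * h)%g (smul a b).
Proof.
by move=> [a' ->] [b' ->]; eexists; exact: (fsmul_delta cp_laws).
Qed.

Lemma cp_degS g a : cp_deg g a -> cp_deg g^-1%g (star a).
Proof. by move=> [a' ->]; eexists; exact: (fsstar_delta cp_laws). Qed.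

Definition crossed : gralg sg G := GrAlg cp_deg_sum cp_degM cp_degS.
End Objects.

Section Morphisms.
Variables (A B : galg sg G) (f : galg_hom A B).

Lemma crossed_map_hom :
  @is_star_hom l sg (crossed A) (crossed B) (fsmap id f).
Proof.
have hf := galg_funP f; have fD := shD hf.
apply: fsmap_star_hom => [||s a]; first exact: shL hf.
- by move=> s a t b; rewrite /cp_gm fsmap_delta // (shM hf) galg_fun_act.
- by rewrite /cp_gs fsmap_delta // galg_fun_act (shS hf).
Qed.

Lemma crossed_map_deg g (a : crossed A) : gdeg g a ->
  gdeg g (fsmap id f a : crossed B).
Proof.
move=> [a' ->]; exists (f a'); rewrite fsmap_delta //.
exact: (shD (galg_funP f)).
Qed.

Definition crossed_map : gralg_hom (crossed A) (crossed B) :=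
  @GrAlgHom l sg G (crossed A) (crossed B) _ crossed_map_hom crossed_map_deg.
End Morphisms.
End CrossedProduct.

Section DualCrossedProduct.
Variables (l : comPzRingType) (sg : conjugation l) (G : groupType).

Lemma gdeg_dec_smul (B : gralg sg G) p q (b c : B) : gdeg p b ->
  dec (gdeg_sum B) (smul b c) q = smul b (dec (gdeg_sum B) c (p^-1 * q)%g).
Proof.
move=> Db; elim/(dec_ind (gdeg_sum B)): c => [|c c' ec ec'|r c Dc].
- by rewrite smulr0 (dec_hom _ (ds0 (gdeg_sum B) 1%g)) delta0 smulr0.
- by rewrite smulDr !decD !fsDE ec ec' smulDr.
rewrite (dec_hom _ Dc) (dec_hom _ (gdegM Db Dc)) !deltaE.
rewrite -[(p^-1 * q)%g == r](inj_eq (mulgI p)) mulVKg; case: eqP => // _.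
by rewrite smulr0.
Qed.

Section Objects.
Variable B : gralg sg G.
Let decB := dec (gdeg_sum B).

(* [delta g b] is the element chi_g |x b. When b is homogeneous of degree |b|,
   its component of degree g^-1 h is b if h = g |b| and 0 otherwise, so that
   [dp_gm] is the usual formula; see [dp_gmE] and [dp_gsE]. *)
Definition dp_gm (g : G) (b : B) (h : G) (c : B) : fs G B :=
  delta g (smul (decB b (g^-1 * h)%g) c).

Definition dp_gs (g : G) (b : B) : fs G B :=
  lext (fun k bk => delta (g * k)%g (star bk)) (decB b).

Lemma dp_gmE g b h c k : gdeg k b ->
  dp_gm g b h c = if h == (g * k)%g then delta g (smul b c) else 0.
Proof.
move=> Db; rewrite /dp_gm /decB (dec_hom _ Db) deltaE -[(g^-1 * h)%g == k](inj_eq (mulgI g)) mulVKg.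
by case: eqP => // _; rewrite smul0r delta0.
Qed.

Let starDl (g k : G) : {morph (fun b : B => delta (g * k)%g (star b)) : a b / a + b}.
Proof. by move=> a b; rewrite starD deltaD. Qed.

Lemma dp_gsE g b k : gdeg k b -> dp_gs g b = delta (g * k)%g (star b).
Proof. by move=> Db; rewrite /dp_gs /decB (dec_hom _ Db) (lext_delta (starDl g)). Qed.

Lemma dp_laws : generator_laws sg dp_gm dp_gs.
Proof.
have dD := @decD _ _ _ _ (gdeg_sum B).
have gmDl s t b : {morph (fun a => dp_gm s a t b) : a a' / a + a'}.
  by move=> a a'; rewrite /dp_gm /decB dD smulDl deltaD.
have gmDr s a t : {morph dp_gm s a t : b b' / b + b'}.
  by move=> b b'; rewrite /dp_gm smulDr deltaD.
have gsD s : {morph dp_gs s : a b / a + b}.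
  by move=> a b; rewrite /dp_gs /decB dD (lextD (starDl s)).
have gs0 s : dp_gs s 0 = 0.
  by rewrite (dp_gsE s (ds0 (gdeg_sum B) 1%g)) star0 delta0.
have gm0l s t b : dp_gm s 0 t b = 0.
  by rewrite /dp_gm /decB (dec_hom _ (ds0 (gdeg_sum B) 1%g)) delta0 smul0r delta0.
have gm0r s a t : dp_gm s a t 0 = 0 by rewrite /dp_gm smulr0 delta0.
split=> //.
- by move=> s c a t b; rewrite /dp_gm /decB decZ smulZl deltaZ.
- by move=> s a t c b; rewrite /dp_gm smulZr deltaZ.
- move=> s a t b u c; rewrite {2 4}/dp_gm !lext_delta // /dp_gm.
  congr delta; rewrite /decB (gdeg_dec_smul _ _ (dec_in _ _ _)) -smulA.
  by rewrite invgM invgK mulgA mulgK.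
- move=> s c a; rewrite /dp_gs /decB decZ.
  apply: (lextZ (sg := sg)) => k; first exact: starDl.
  by move=> d b; rewrite starZ deltaZ.
- move=> s a; elim/(dec_ind (gdeg_sum B)): a => [|a a' ea ea'|k a Da].
  + by rewrite gs0 lext0 // delta0.
  + by rewrite gsD lextD // ea ea' deltaD.
  + by rewrite (dp_gsE s Da) lext_delta // (dp_gsE _ (gdegS Da)) starK mulgK.
- move=> s a t b; have mDr := fsmulDr gmDl gmDr; have mDl := fsmulDl gmDl gmDr.
  elim/(dec_ind (gdeg_sum B)): a => [|a a' ea ea'|k a Da].
  + by rewrite gm0l gs0 lext0 // (fsmulr0 gmDl gmDr).
  + by rewrite gmDl gsD lextD // ea ea' mDr.
  elim/(dec_ind (gdeg_sum B)): b => [|b b' eb eb'|r b Db].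
  + by rewrite gm0r gs0 lext0 // (fsmul0r gmDl gmDr).
  + by rewrite gmDr gsD lextD // eb eb' mDl.
  rewrite (dp_gmE _ _ _ Da) (dp_gsE _ Da) (dp_gsE _ Db) (fsmul_gen gmDl gmDr).
  rewrite (dp_gmE _ _ _ (gdegS Db)) mulgK eq_sym.
  case: eqP => [<-|_]; last by rewrite lext0.
  by rewrite lext_delta // (dp_gsE _ (gdegM Da Db)) starM mulgA.
Qed.

Definition dp_act (h : G) : fs_staralg dp_laws -> fs_staralg dp_laws :=
  fsmap (fun k => (h * k)%g) id.

Lemma dp_act_hom h : is_star_hom (dp_act h).
Proof.
apply: fsmap_star_hom => // [s a t b|s a].
  by rewrite /dp_gm fsmap_delta // invgM -mulgA mulKg.
elim/(dec_ind (gdeg_sum B)): a => [|a a' ea ea'|k a Da].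
- by rewrite !(dp_gsE _ (ds0 (gdeg_sum B) 1%g)) star0 !delta0 fsmap0.
- have D u := gsD dp_laws u.
  by rewrite !D fsmapD // ea ea'.
- by rewrite !(dp_gsE _ Da) fsmap_delta // mulgA.
Qed.

Lemma dp_act1 f : dp_act 1%g f = f.
Proof. by apply: fsmap_id => // g; rewrite mul1g. Qed.

Lemma dp_actM g h f : dp_act (g * h)%g f = dp_act g (dp_act h f).
Proof.
rewrite /dp_act fsmap_comp //.
by apply: eq_fsmap => // k; rewrite /= mulgA.
Qed.

Definition dual_crossed : galg sg G := GAlg dp_act_hom dp_act1 dp_actM.
End Objects.

Section Morphisms.
Variables (A B : gralg sg G) (f : gralg_hom A B).

Lemma gralg_fun_dec a k :
  f (dec (gdeg_sum A) a k) = dec (gdeg_sum B) (f a) k.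
Proof.
have fD := shD (gralg_funP f); have f0 := sh0 (gralg_funP f).
elim/(dec_ind (gdeg_sum A)): a => [|a a' ea ea'|r a Da].
- rewrite f0 (dec_hom _ (ds0 (gdeg_sum A) 1%g)) (dec_hom _ (ds0 (gdeg_sum B) 1%g)).
  by rewrite !delta0 f0.
- by rewrite fD !decD !fsDE fD ea ea'.
- rewrite (dec_hom _ Da) (dec_hom _ (gralg_fun_deg f Da)) !deltaE.
  by case: eqP.
Qed.

Lemma dual_crossed_map_hom :
  @is_star_hom l sg (dual_crossed A) (dual_crossed B) (fsmap id f).
Proof.
have hf := gralg_funP f; have fD := shD hf.
apply: fsmap_star_hom => [||s a]; first exact: shL hf.
- by move=> s a t b; rewrite /dp_gm fsmap_delta // (shM hf) gralg_fun_dec.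
elim/(dec_ind (gdeg_sum A)): a => [|a a' ea ea'|k a Da].
- rewrite (dp_gsE _ (ds0 (gdeg_sum A) 1%g)) (sh0 hf).
  by rewrite (dp_gsE _ (ds0 (gdeg_sum B) 1%g)) !star0 !delta0 fsmap0.
- have D u := gsD (dp_laws A) u; have D' u := gsD (dp_laws B) u.
  by rewrite D fsmapD // ea ea' fD D'.
- rewrite (dp_gsE _ Da) (dp_gsE _ (gralg_fun_deg f Da)) fsmap_delta //.
  by rewrite (shS hf).
Qed.

Lemma dual_crossed_map_act h (a : dual_crossed A) :
  fsmap id f (gact h a) = gact h (fsmap id f a : dual_crossed B).
Proof.
have fD := shD (gralg_funP f).
rewrite [LHS]fsmap_comp //.
by rewrite [RHS]fsmap_comp.
Qed.

Definition dual_crossed_map : galg_hom (dual_crossed A) (dual_crossed B) :=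
  @GAlgHom l sg G (dual_crossed A) (dual_crossed B) _ dual_crossed_map_hom
    dual_crossed_map_act.
End Morphisms.
End DualCrossedProduct.

(* Categories are indexed by their type of objects, and functors by their map
   on objects: "identity on objects" and strict equality of composites of
   functors can then be stated without transport. *)
Record category (O : Type) := Category {
  hom : O -> O -> Type;
  idm : forall a, hom a a;
  comp : forall a b c, hom b c -> hom a b -> hom a c;
  compA : forall a b c d (h : hom c d) (g : hom b c) (f : hom a b),
    comp h (comp g f) = comp (comp h g) f;
  comp1m : forall a b (f : hom a b), comp (idm b) f = f;
  compm1 : forall a b (f : hom a b), comp f (idm a) = f }.

Definition is_iso (O : Type) (C : category O) (a b : O) (f : hom C a b) : Prop :=
  exists g : hom C b a, comp g f = idm C a /\ comp f g = idm C b.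

Record functor (O O' : Type) (C : category O) (D : category O') (F0 : O -> O') :=
  Functor {
  fmap : forall a b, hom C a b -> hom D (F0 a) (F0 b);
  fmap1 : forall a, fmap (idm C a) = idm D (F0 a);
  fmapM : forall a b c (g : hom C b c) (f : hom C a b),
    fmap (comp g f) = comp (fmap g) (fmap f) }.

Record addcat (O : Type) := AddCat {
  ahom : O -> O -> zmodType;
  aid : forall a, ahom a a;
  acomp : forall a b c, ahom b c -> ahom a b -> ahom a c;
  acompA : forall a b c d (h : ahom c d) (g : ahom b c) (f : ahom a b),
    acomp h (acomp g f) = acomp (acomp h g) f;
  acomp1m : forall a b (f : ahom a b), acomp (aid b) f = f;
  acompm1 : forall a b (f : ahom a b), acomp f (aid a) = f;
  acompDl : forall a b c (f : ahom a b),
    {morph (fun g : ahom b c => acomp g f) : g g' / g + g'};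
  acompDr : forall a b c (g : ahom b c),
    {morph (fun f : ahom a b => acomp g f) : f f' / f + f'};
  azero : exists z, forall a,
    (forall f : ahom a z, f = 0) /\ (forall f : ahom z a, f = 0);
  abiprod : forall a b, exists (s : O) (i : ahom a s) (j : ahom b s)
      (p : ahom s a) (q : ahom s b),
    [/\ acomp p i = aid a, acomp q j = aid b, acomp p j = 0, acomp q i = 0
      & acomp i p + acomp j q = aid s] }.

Definition cat_of_addcat (O : Type) (C : addcat O) : category O :=
  Category (@acompA O C) (@acomp1m O C) (@acompm1 O C).
Coercion cat_of_addcat : addcat >-> category.

Definition is_zero (O : Type) (C : addcat O) (z : O) : Prop :=
  forall a, (forall f : ahom C a z, f = 0) /\ (forall f : ahom C z a, f = 0).

(* A triangulated category presented by its inverse suspension [Om], an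
   autoequivalence. The triangle Om c -> a -> b -> c stands for the triangle
   Om c -> a -> b -> Sigma (Om c) of the usual presentation; [dist_rot] and
   [dist_octa] are the usual axioms transcribed along this. *)
Record tricat (O : Type) := TriCat {
  tadd :> addcat O;
  Om : O -> O;
  OmF : functor tadd tadd Om;
  OmD : forall a b (f g : ahom tadd a b),
    fmap OmF (f + g : ahom tadd a b) =
    (fmap OmF f : ahom tadd (Om a) (Om b)) + fmap OmF g;
  Om_full_faithful : forall a b, bijective (@fmap _ _ _ _ _ OmF a b);
  Om_ess_surj : forall a, exists b (f : hom tadd (Om b) a), is_iso f;
  dist : forall a b c, ahom tadd (Om c) a -> ahom tadd a b -> ahom tadd b c -> Prop;
  dist_iso : forall a b c a' b' c'
      (f : ahom tadd (Om c) a) (g : ahom tadd a b) (h : ahom tadd b c)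
      (f' : ahom tadd (Om c') a') (g' : ahom tadd a' b') (h' : ahom tadd b' c')
      (u : hom tadd a a') (v : hom tadd b b') (w : hom tadd c c'),
    is_iso u -> is_iso v -> is_iso w ->
    acomp u f = acomp f' (fmap OmF w) -> acomp v g = acomp g' u ->
    acomp w h = acomp h' v -> dist f g h -> dist f' g' h';
  dist_id : forall a z, is_zero tadd z ->
    dist (0 : ahom tadd (Om a) z) (0 : ahom tadd z a) (aid tadd a);
  dist_complete : forall b c (h : ahom tadd b c),
    exists a (f : ahom tadd (Om c) a) (g : ahom tadd a b), dist f g h;
  dist_rot : forall a b c
      (f : ahom tadd (Om c) a) (g : ahom tadd a b) (h : ahom tadd b c),
    dist f g h <-> dist (- (fmap OmF h : ahom tadd (Om b) (Om c))) f g;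
  dist_mor : forall a b c a' b' c'
      (f : ahom tadd (Om c) a) (g : ahom tadd a b) (h : ahom tadd b c)
      (f' : ahom tadd (Om c') a') (g' : ahom tadd a' b') (h' : ahom tadd b' c')
      (v : ahom tadd b b') (w : ahom tadd c c'),
    dist f g h -> dist f' g' h' -> acomp w h = acomp h' v ->
    exists u : ahom tadd a a',
      acomp u f = acomp f' (fmap OmF w) /\ acomp v g = acomp g' u;
  dist_octa : forall a b c x y z (s : ahom tadd a b) (t : ahom tadd b c)
      (ds : ahom tadd (Om b) x) (ks : ahom tadd x a)
      (dt : ahom tadd (Om c) y) (kt : ahom tadd y b)
      (dts : ahom tadd (Om c) z) (kts : ahom tadd z a),
    dist ds ks s -> dist dt kt t -> dist dts kts (acomp t s) ->
    exists (u : ahom tadd x z) (v : ahom tadd z y),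
      [/\ dist (acomp ds (fmap OmF kt)) u v,
          acomp kts u = ks,
          acomp kt v = acomp s kts,
          acomp v dts = dt
        & acomp u ds = acomp dts (fmap OmF t)] }.

Record trifunctor (O O' : Type) (T : tricat O) (T' : tricat O') (F0 : O -> O') :=
  TriFunctor {
  tf :> functor T T' F0;
  tfD : forall a b (f g : ahom T a b),
    fmap tf (f + g : ahom T a b) =
    (fmap tf f : ahom T' (F0 a) (F0 b)) + fmap tf g;
  tf_om : forall a, hom T' (F0 (Om T a)) (Om T' (F0 a));
  tf_om_iso : forall a, is_iso (tf_om a);
  tf_om_nat : forall a b (f : hom T a b),
    comp (tf_om b) (fmap tf (fmap (OmF T) f)) =
    comp (fmap (OmF T') (fmap tf f)) (tf_om a);
  tf_dist : forall a b c (f : hom T (Om T c) a) (g : hom T a b) (h : hom T b c)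
      (f' : hom T' (Om T' (F0 c)) (F0 a)),
    dist f g h -> comp f' (tf_om c) = fmap tf f ->
    dist f' (fmap tf g) (fmap tf h) }.

Section TriFunctors.
Variables (O O' O'' : Type) (T : tricat O) (T' : tricat O') (T'' : tricat O'').

Lemma iso_id (C : category O) a : is_iso (idm C a).
Proof. by exists (idm C a); rewrite comp1m. Qed.

Lemma iso_comp (C : category O) a b c (g : hom C b c) (f : hom C a b) :
  is_iso g -> is_iso f -> is_iso (comp g f).
Proof.
move=> [g' [g1 g2]] [f' [f1 f2]]; exists (comp f' g'); split.
  by rewrite -compA [comp g' _]compA g1 comp1m.
by rewrite -compA [comp f _]compA f2 comp1m.
Qed.

Lemma fmap_iso (C : category O) (D : category O') F0 (F : functor C D F0)
  a b (f : hom C a b) : is_iso f -> is_iso (fmap F f).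
Proof.
by move=> [g [g1 g2]]; exists (fmap F g); rewrite -!fmapM g1 g2 !fmap1.
Qed.

Definition id_functor (C : category O) : functor C C (fun a => a) :=
  @Functor _ _ C C (fun a => a) (fun _ _ f => f) (fun _ => erefl)
    (fun _ _ _ _ _ => erefl).

Lemma comp_functor1 (C : category O) (D : category O') (E : category O'') F0 G0
    (F : functor C D F0) (H : functor D E G0) a :
  fmap H (fmap F (idm C a)) = idm E (G0 (F0 a)).
Proof. by rewrite !fmap1. Qed.

Lemma comp_functorM (C : category O) (D : category O') (E : category O'') F0 G0
    (F : functor C D F0) (H : functor D E G0) a b c (g : hom C b c) (f : hom C a b) :
  fmap H (fmap F (comp g f)) = comp (fmap H (fmap F g)) (fmap H (fmap F f)).
Proof. by rewrite !fmapM. Qed.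

Definition comp_functor (C : category O) (D : category O') (E : category O'') F0 G0
    (H : functor D E G0) (F : functor C D F0) : functor C E (fun a => G0 (F0 a)) :=
  @Functor _ _ C E (fun a => G0 (F0 a)) (fun a b f => fmap H (fmap F f))
    (comp_functor1 F H) (comp_functorM F H).
End TriFunctors.

Section TriFunctorOps.
Variables (O O' O'' : Type) (T : tricat O) (T' : tricat O') (T'' : tricat O'').

Lemma id_tri_nat a b (f : hom T a b) :
  comp (idm T (Om T b)) (fmap (OmF T) f) = comp (fmap (OmF T) f) (idm T (Om T a)).
Proof. by rewrite compm1 comp1m. Qed.

Lemma id_tri_dist a b c (f : hom T (Om T c) a) (g : hom T a b) (h : hom T b c)
    (f' : hom T (Om T c) a) :
  dist f g h -> comp f' (idm T (Om T c)) = f -> dist f' g h.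
Proof. by rewrite compm1 => ? ->. Qed.

Definition id_trifunctor : trifunctor T T (fun a => a) :=
  @TriFunctor _ _ T T (fun a => a) (id_functor T) (fun _ _ _ _ => erefl)
    (fun a => idm T (Om T a)) (fun a => iso_id T (Om T a)) id_tri_nat id_tri_dist.

Variables (F0 : O -> O') (G0 : O' -> O'').
Variables (H : trifunctor T' T'' G0) (F : trifunctor T T' F0).

Lemma comp_triD a b (f g : ahom T a b) :
  fmap (comp_functor H F) (f + g : ahom T a b) =
  (fmap (comp_functor H F) f : ahom T'' _ _) + fmap (comp_functor H F) g.
Proof. by rewrite /= !tfD. Qed.

Definition comp_tri_om a : hom T'' (G0 (F0 (Om T a))) (Om T'' (G0 (F0 a))) :=
  comp (tf_om H (F0 a)) (fmap H (tf_om F a)).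

Lemma comp_tri_iso a : is_iso (comp_tri_om a).
Proof.
by apply: iso_comp; [exact: tf_om_iso | apply: fmap_iso; exact: tf_om_iso].
Qed.

Lemma comp_tri_nat a b (f : hom T a b) :
  comp (comp_tri_om b) (fmap (comp_functor H F) (fmap (OmF T) f)) =
  comp (fmap (OmF T'') (fmap (comp_functor H F) f)) (comp_tri_om a).
Proof.
rewrite /comp_tri_om.
rewrite -[fmap (comp_functor H F) f]/(fmap H (fmap F f)).
rewrite -[fmap (comp_functor H F) _]/(fmap H (fmap F (fmap (OmF T) f))).
rewrite -compA -fmapM tf_om_nat fmapM !compA.
by rewrite tf_om_nat.
Qed.

Lemma comp_tri_dist a b c (f : hom T (Om T c) a) (g : hom T a b) (h : hom T b c)
    (f' : hom T'' (Om T'' (G0 (F0 c))) (G0 (F0 a))) :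
  dist f g h -> comp f' (comp_tri_om c) = fmap (comp_functor H F) f ->
  dist f' (fmap (comp_functor H F) g) (fmap (comp_functor H F) h).
Proof.
move=> fgh e; have [k [k1 k2]] := tf_om_iso F c.
have := @tf_dist _ _ _ _ _ F _ _ _ _ _ _ (comp (fmap F f) k) fgh.
rewrite -compA k1 compm1 => /(_ erefl) d.
apply: (@tf_dist _ _ _ _ _ H _ _ _ _ _ _ f' d); rewrite fmapM.
have -> : fmap H (fmap F f) = comp f' (comp_tri_om c) by [].
rewrite /comp_tri_om.
by rewrite -!compA -fmapM k2 fmap1 compm1.
Qed.

Definition comp_trifunctor : trifunctor T T'' (fun a => G0 (F0 a)) :=
  TriFunctor comp_triD comp_tri_iso comp_tri_nat comp_tri_dist.

End TriFunctorOps.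

Definition tri_natiso (O O' : Type) (T : tricat O) (T' : tricat O')
    (F0 F0' : O -> O') (F : trifunctor T T' F0) (F' : trifunctor T T' F0') : Prop :=
  exists eta : forall a, hom T' (F0 a) (F0' a),
    [/\ forall a, is_iso (eta a),
        forall a b (f : hom T a b), comp (eta b) (fmap F f) = comp (fmap F' f) (eta a)
      & forall a, comp (tf_om F' a) (eta (Om T a)) =
                  comp (fmap (OmF T') (eta a)) (tf_om F a)].

(* A category with a distinguished class of short exact sequences. *)
Record extcat (O : Type) := ExtCat {
  ecat :> category O;
  is_ext : forall A B C, hom ecat A B -> hom ecat B C -> Prop }.

Record excisive_theory (O O' : Type) (E : extcat O) (T : tricat O') (H0 : O -> O') :=
  ExcisiveTheory {
  ht :> functor E T H0;
  bd : forall A B C (i : hom E A B) (p : hom E B C),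
    is_ext i p -> hom T (Om T (H0 C)) (H0 A);
  bd_nat : forall A B C A' B' C' (i : hom E A B) (p : hom E B C)
      (i' : hom E A' B') (p' : hom E B' C') (e : is_ext i p) (e' : is_ext i' p')
      (u : hom E A A') (v : hom E B B') (w : hom E C C'),
    comp v i = comp i' u -> comp w p = comp p' v ->
    comp (fmap ht u) (bd e) = comp (bd e') (fmap (OmF T) (fmap ht w));
  bd_dist : forall A B C (i : hom E A B) (p : hom E B C) (e : is_ext i p),
    dist (bd e) (fmap ht i) (fmap ht p) }.

(* F is a morphism of homology theories from J to H: F o J = H on the nose, and
   F maps the boundary maps of J to those of H, up to the structural
   isomorphism F Om = Om F. *)
Definition extends_theory (O O' O'' : Type) (E : extcat O) (T : tricat O')
    (T' : tricat O'') (J0 : O -> O') (F0 : O' -> O'')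
    (J : excisive_theory E T J0) (H : excisive_theory E T' (fun A => F0 (J0 A)))
    (F : trifunctor T T' F0) : Prop :=
  (forall A B (f : hom E A B), fmap F (fmap J f) = fmap H f) /\
  (forall A B C (i : hom E A B) (p : hom E B C) (e : is_ext i p),
     fmap F (bd J e) = comp (bd H e) (tf_om F (J0 C))).

Definition functor_property (O : Type) (C : category O) :=
  forall (O' : Type) (D : category O') (H0 : O -> O'), functor C D H0 -> Prop.

(* An initial object among the excisive homology theories on E satisfying P,
   whose functor jj : E -> kk is the identity on objects. *)
Record initial_theory (O : Type) (E : extcat O) (P : functor_property E) :=
  InitialTheory {
  kk : tricat O;
  jj : excisive_theory E kk (fun A => A);
  jj_prop : P O kk (fun A => A) jj;
  jj_extend : forall (O' : Type) (T : tricat O') (H0 : O -> O')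
    (H : excisive_theory E T H0), P O' T H0 H ->
    exists F : trifunctor kk T H0, extends_theory jj H F;
  jj_unique : forall (O' : Type) (T : tricat O') (H0 : O -> O')
    (H : excisive_theory E T H0), P O' T H0 H ->
    forall F F' : trifunctor kk T H0,
      extends_theory jj H F -> extends_theory jj H F' ->
      (forall A B (f : hom kk A B), fmap F f = fmap F' f) /\
      (forall A, tf_om F A = tf_om F' A) }.

Section HermitianKK.
Variables (l : comPzRingType) (sg : conjugation l) (G : groupType) (frakX : choiceType).

Lemma galg_compA (A B C D : galg sg G) (h : galg_hom C D) (g : galg_hom B C)
    (f : galg_hom A B) : galg_comp h (galg_comp g f) = galg_comp (galg_comp h g) f.
Proof. exact: galg_hom_eq. Qed.

Lemma galg_comp1m (A B : galg sg G) (f : galg_hom A B) : galg_comp (galg_id B) f = f.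
Proof. exact: galg_hom_eq. Qed.

Lemma galg_compm1 (A B : galg sg G) (f : galg_hom A B) : galg_comp f (galg_id A) = f.
Proof. exact: galg_hom_eq. Qed.

Definition galg_cat : category (galg sg G) :=
  @Category (galg sg G) (@galg_hom l sg G) (@galg_id l sg G) (@galg_comp l sg G)
    galg_compA galg_comp1m galg_compm1.

Lemma gralg_compA (A B C D : gralg sg G) (h : gralg_hom C D) (g : gralg_hom B C)
    (f : gralg_hom A B) : gralg_comp h (gralg_comp g f) = gralg_comp (gralg_comp h g) f.
Proof. exact: gralg_hom_eq. Qed.

Lemma gralg_comp1m (A B : gralg sg G) (f : gralg_hom A B) : gralg_comp (gralg_id B) f = f.
Proof. exact: gralg_hom_eq. Qed.

Lemma gralg_compm1 (A B : gralg sg G) (f : gralg_hom A B) : gralg_comp f (gralg_id A) = f.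
Proof. exact: gralg_hom_eq. Qed.

Definition gralg_cat : category (gralg sg G) :=
  @Category (gralg sg G) (@gralg_hom l sg G) (@gralg_id l sg G) (@gralg_comp l sg G)
    gralg_compA gralg_comp1m gralg_compm1.

Definition exact_seq (A B C : staralg sg) (i : A -> B) (p : B -> C) : Prop :=
  [/\ injective i, range i = [set b | p b = 0] & range p = [set: C]].

Definition galg_ext (A B C : galg sg G) (i : galg_hom A B) (p : galg_hom B C) : Prop :=
  exact_seq i p /\
  exists s : C -> B, [/\ linear s, forall g c, s (gact g c) = gact g (s c) & cancel s p].

Definition gralg_ext (A B C : gralg sg G) (i : gralg_hom A B) (p : gralg_hom B C) : Prop :=
  exact_seq i p /\
  exists s : C -> B, [/\ linear s, forall g c, gdeg g c -> gdeg g (s c) & cancel s p].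

Definition galg_extcat : extcat (galg sg G) := @ExtCat _ galg_cat galg_ext.
Definition gralg_extcat : extcat (gralg sg G) := @ExtCat _ gralg_cat gralg_ext.

Section EquivariantStability.
Variables (O' : Type) (D : category O') (H0 : galg sg G -> O').
Variable (H : functor galg_cat D H0).

Definition gMX_stable := forall (A : galg sg G) (x : frakX),
  is_iso (fmap H (gmx_corner A x : hom galg_cat _ _)).

Definition giota_stable := forall A : galg sg G,
  is_iso (fmap H (gpm_corner A : hom galg_cat _ _)).

(* X must be nonempty: the algebra of empty matrices is 0, so inverting
   M_X A -> M_(X + Y) A for empty X would force every M_Y A, hence every A, to
   be sent to 0. The same applies to [grG_stable]. *)
Definition gG_stable := forall (A : galg sg G) (X Y : gset G),
  [set: X] !=set0 -> ([set: X] #<= [set: frakX])%card -> ([set: Y] #<= [set: frakX])%card ->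
  is_iso (fmap H (gmx_inl A X Y : hom galg_cat _ _)).

Definition ghomotopy_invariant := forall A : galg sg G,
  is_iso (fmap H (gpl_const A : hom galg_cat _ _)).

Definition ghermitian_stable :=
  [/\ gG_stable, ghomotopy_invariant, gMX_stable & giota_stable].
End EquivariantStability.

Section GradedStability.
Variables (O' : Type) (D : category O') (H0 : gralg sg G -> O').
Variable (H : functor gralg_cat D H0).

Definition grMX_stable := forall (A : gralg sg G) (x : frakX),
  is_iso (fmap H (grmx_corner A x : hom gralg_cat _ _)).

Definition griota_stable := forall A : gralg sg G,
  is_iso (fmap H (grpm_corner A : hom gralg_cat _ _)).

Definition grG_stable := forall (A : gralg sg G) (X Y : grset G),
  [set: X] !=set0 -> ([set: X] #<= [set: frakX])%card -> ([set: Y] #<= [set: frakX])%card ->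
  is_iso (fmap H (grmx_inl A X Y : hom gralg_cat _ _)).

Definition grhomotopy_invariant := forall A : gralg sg G,
  is_iso (fmap H (grpl_const A : hom gralg_cat _ _)).

Definition grhermitian_stable :=
  [/\ grG_stable, grhomotopy_invariant, grMX_stable & griota_stable].
End GradedStability.

Definition kkh_equivariant := @initial_theory (galg sg G) galg_extcat ghermitian_stable.
Definition kkh_graded := @initial_theory (gralg sg G) gralg_extcat grhermitian_stable.

Lemma crossed_map1 (A : galg sg G) : crossed_map (galg_id A) = gralg_id (crossed A).
Proof. by apply: gralg_hom_eq => x; apply: fsmap_id. Qed.

Lemma crossed_mapM (A B C : galg sg G) (g : galg_hom B C) (f : galg_hom A B) :
  crossed_map (galg_comp g f) = gralg_comp (crossed_map g) (crossed_map f).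
Proof.
apply: gralg_hom_eq => x; rewrite [RHS]fsmap_comp //.
- exact: shD (galg_funP f).
- exact: shD (galg_funP g).
Qed.

Definition crossed_functor : functor galg_cat gralg_cat (@crossed l sg G) :=
  @Functor _ _ galg_cat gralg_cat (@crossed l sg G) (@crossed_map l sg G)
    crossed_map1 crossed_mapM.

Lemma dual_crossed_map1 (A : gralg sg G) :
  dual_crossed_map (gralg_id A) = galg_id (dual_crossed A).
Proof. by apply: galg_hom_eq => x; apply: fsmap_id. Qed.

Lemma dual_crossed_mapM (A B C : gralg sg G) (g : gralg_hom B C) (f : gralg_hom A B) :
  dual_crossed_map (gralg_comp g f) =
  galg_comp (dual_crossed_map g) (dual_crossed_map f).
Proof.
apply: galg_hom_eq => x; rewrite [RHS]fsmap_comp //.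
- exact: shD (gralg_funP f).
- exact: shD (gralg_funP g).
Qed.

Definition dual_crossed_functor : functor gralg_cat galg_cat (@dual_crossed l sg G) :=
  @Functor _ _ gralg_cat galg_cat (@dual_crossed l sg G) (@dual_crossed_map l sg G)
    dual_crossed_map1 dual_crossed_mapM.

End HermitianKK.

(* Main.v *)
From Pilot Require Import Defs.
From HB Require Import structures.
From mathcomp Require Import all_boot all_algebra finmap.
From mathcomp Require Import boolp classical_sets functions cardinality fsbigop.
(* [hom] and [comp] must denote the operations of a category, not linear maps
   and composition of functions. *)
Import Pilot.Defs.

Set Implicit Arguments.
Unset Strict Implicit.
Unset Printing Implicit Defensive.

Import GRing.Theory.
Local Open Scope classical_set_scope.
Local Open Scope ring_scope.

(** Both crossed products act on the underlying modules by applying a morphism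
    coefficientwise, so they preserve extensions with equivariant, respectively
    degree-preserving, sections. Composing them with the universal theories
    [jj L] and [jj K] therefore gives excisive theories on G-*-algebras and on
    graded *-algebras, and the functors F and F' of the theorem come from
    initiality as soon as these theories are stable.

    Stability holds because the crossed products turn matrices indexed by a
    G-set or a graded set into matrices with trivial index action or degree:
      - (M_X A) x| G = M_X (A x| G), X on the right having trivial degrees, by
        e_{x,y} a x| g |-> e_{x, g^-1 y} (a x| g)  ([crossed_mx]);
      - G |x (M_X B) = M_X (G |x B), X on the right having trivial action, by
        chi_g |x e_{x,y} b |-> e_{x,y} (chi_{g|x|} |x b)  ([dual_mx]);
    and they commute with A[t] and with M_+- A ([crossed_pl], [crossed_pm],
    [dual_pl], [dual_pm]). See [crossed_stable] and [dual_stable].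

    That F and F' are inverse to each other rests on Imai-Takai duality at the
    level of algebras: [takai] identifies G |x (A x| G) with M_G A for G acting
    on itself by translation, and [gr_takai] identifies (G |x B) x| G with
    M_G B for G graded by itself. A stable theory identifies A with M_G A
    through the two corners A -> M_{1+G} A <- M_G A, where 1 is a point. All
    this is natural and takes place between exact functors, so it is an
    isomorphism eta between the theories A |-> jj K A and
    A |-> jj K (G |x (A x| G)) that respects boundary maps
    ([takai_theory_iso], [gr_takai_theory_iso]).

    It remains to see that eta, natural with respect to algebra morphisms, is
    natural with respect to all morphisms of kk. Conjugating the identity of kk
    by eta produces a triangulated functor ([conj_trifunctor]) which extends
    the same theory as F' o F does; by the uniqueness part of initiality the
    two coincide, and eta is an isomorphism between F' o F and the identity
    ([comp_natiso_id]). *)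

(** * Homology theories, their isomorphisms and initiality *)

Section Isomorphisms.
Variables (O : Type) (C : category O).

Definition iso_inv a b (f : hom C a b) (hf : is_iso f) : hom C b a := projT1 (cid hf).

Lemma iso_invK a b (f : hom C a b) (hf : is_iso f) : comp (iso_inv hf) f = idm C a.
Proof. by rewrite /iso_inv; case: cid => g /= []. Qed.

Lemma iso_Kinv a b (f : hom C a b) (hf : is_iso f) : comp f (iso_inv hf) = idm C b.
Proof. by rewrite /iso_inv; case: cid => g /= []. Qed.

Lemma iso_inv_iso a b (f : hom C a b) (hf : is_iso f) : is_iso (iso_inv hf).
Proof. by exists f; rewrite iso_invK iso_Kinv. Qed.

Lemma iso_cancelr a b c (f : hom C a b) (g h : hom C b c) :
  is_iso f -> comp g f = comp h f -> g = h.
Proof.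
by move=> [k [_ fk]] e; rewrite -[g]compm1 -[h]compm1 -fk !compA e.
Qed.

Lemma iso_cancell a b c (f : hom C b c) (g h : hom C a b) :
  is_iso f -> comp f g = comp f h -> g = h.
Proof.
by move=> [k [kf _]] e; rewrite -[g]comp1m -[h]comp1m -kf -!compA e.
Qed.

Lemma iso_square a b c d (f : hom C a b) (g : hom C c d) (u : hom C a c) (v : hom C b d) :
  is_iso u -> is_iso v -> is_iso g -> comp v f = comp g u -> is_iso f.
Proof.
move=> hu hv hg e.
have -> : f = comp (iso_inv hv) (comp g u) by rewrite -e compA iso_invK comp1m.
by apply: iso_comp; [exact: iso_inv_iso | exact: iso_comp].
Qed.
End Isomorphisms.

(** Used to replace an algebra map by an isomorphic one when checking that a
    functor inverts it. *)
Lemma is_iso_square_image (O O' : Type) (C : category O) (D : category O') (H0 : O -> O')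
    (H : functor C D H0) a b c d
    (f : hom C a b) (g : hom C c d) (u : hom C a c) (v : hom C b d) :
  is_iso u -> is_iso v -> comp v f = comp g u -> is_iso (fmap H g) -> is_iso (fmap H f).
Proof.
move=> hu hv e hg; apply: (iso_square (fmap_iso H hu) (fmap_iso H hv) hg).
by rewrite -!fmapM e.
Qed.

Definition exact_functor (O O' : Type) (E : extcat O) (E' : extcat O') (Phi0 : O -> O')
    (Phi : functor E E' Phi0) : Prop :=
  forall A B C (i : hom E A B) (p : hom E B C), is_ext i p -> is_ext (fmap Phi i) (fmap Phi p).

Section Precomposition.
Variables (O O' U : Type) (E : extcat O) (E' : extcat O') (T : tricat U).
Variables (Phi0 : O -> O') (Phi : functor E E' Phi0) (exPhi : exact_functor Phi).
Variables (H0 : O' -> U) (H : excisive_theory E' T H0).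

Lemma precomp_bd_nat A B C A' B' C' (i : hom E A B) (p : hom E B C)
    (i' : hom E A' B') (p' : hom E B' C') (e : is_ext i p) (e' : is_ext i' p')
    (u : hom E A A') (v : hom E B B') (w : hom E C C') :
  comp v i = comp i' u -> comp w p = comp p' v ->
  comp (fmap (comp_functor H Phi) u) (bd H (exPhi e)) =
  comp (bd H (exPhi e')) (fmap (OmF T) (fmap (comp_functor H Phi) w)).
Proof.
move=> vi wp; apply: (bd_nat H (exPhi e) (exPhi e') (v := fmap Phi v)).
  by rewrite -!fmapM vi.
by rewrite -!fmapM wp.
Qed.

Definition theory_precomp : excisive_theory E T (fun A => H0 (Phi0 A)) :=
  @ExcisiveTheory _ _ E T (fun A => H0 (Phi0 A)) (comp_functor H Phi)
    (fun _ _ _ _ _ e => bd H (exPhi e)) precomp_bd_nat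
    (fun _ _ _ _ _ e => bd_dist H (exPhi e)).
End Precomposition.

Section TheoryIso.
Variables (O U : Type) (E : extcat O) (T : tricat U).

(** The values of H and H' need not be equal on objects. Compatibility with the
    boundary maps is what makes [eta] compatible with the structural
    isomorphisms of triangulated functors in [extends_conj]. *)
Definition theory_iso (H0 H0' : O -> U) (H : excisive_theory E T H0)
    (H' : excisive_theory E T H0') (eta : forall A, hom T (H0 A) (H0' A)) : Prop :=
  [/\ forall A, is_iso (eta A),
      forall A B (f : hom E A B), comp (eta B) (fmap H f) = comp (fmap H' f) (eta A)
    & forall A B C (i : hom E A B) (p : hom E B C) (e : is_ext i p),
        comp (eta A) (bd H e) = comp (bd H' e) (fmap (OmF T) (eta C))].

Lemma theory_iso_cospan (H0 H1 H2 : O -> U) (H : excisive_theory E T H0)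
    (H' : excisive_theory E T H1) (H'' : excisive_theory E T H2) eta theta :
  theory_iso H H'' eta -> theory_iso H' H'' theta -> exists zeta, theory_iso H H' zeta.
Proof.
move=> [ei en eb] [ti tn tb]; exists (fun A => comp (iso_inv (ti A)) (eta A)); split.
- by move=> A; apply: iso_comp => //; exact: iso_inv_iso.
- move=> A B f; apply: (iso_cancell (ti B)).
  rewrite !compA iso_Kinv comp1m en tn -!compA; congr comp.
  by rewrite compA iso_Kinv comp1m.
- move=> A B C i p e; apply: (iso_cancell (ti A)).
  rewrite !compA iso_Kinv comp1m eb tb -!compA -fmapM; congr (comp _ (fmap _ _)).
  by rewrite compA iso_Kinv comp1m.
Qed.
End TheoryIso.

(** Compatibility with the boundary maps is free: tau is a morphism between the
    images under Phi and Psi of any extension. *)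
Lemma nat_theory_iso (O O' U : Type) (E : extcat O) (E' : extcat O') (T : tricat U)
    (Phi0 Psi0 : O -> O') (Phi : functor E E' Phi0) (Psi : functor E E' Psi0)
    (exPhi : exact_functor Phi) (exPsi : exact_functor Psi)
    (H0 : O' -> U) (H : excisive_theory E' T H0)
    (tau : forall A, hom E' (Phi0 A) (Psi0 A)) :
  (forall A B (f : hom E A B), comp (tau B) (fmap Phi f) = comp (fmap Psi f) (tau A)) ->
  (forall A, is_iso (fmap H (tau A))) ->
  theory_iso (theory_precomp exPhi H) (theory_precomp exPsi H) (fun A => fmap H (tau A)).
Proof.
move=> tn ti; split=> // [A B f|A B C i p e].
  by have := congr1 (fmap H (b:=_)) (tn A B f); rewrite !fmapM.
exact: (bd_nat H (exPhi _ _ _ _ _ e) (exPsi _ _ _ _ _ e) (tn _ _ i) (tn _ _ p)).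
Qed.

(** Transport of a triangulated functor along isomorphisms [eta a] that carry no
    naturality: the action on morphisms is defined so as to make them natural. *)
Section Conjugation.
Variables (O U : Type) (T : tricat U) (T' : tricat O).
Variables (H0 H1 : U -> O) (F : trifunctor T T' H0).
Variables (eta : forall a, hom T' (H0 a) (H1 a)) (etaI : forall a, is_iso (eta a)).

Let inv a := iso_inv (etaI a).

Definition conj_fmap a b (f : hom T a b) : hom T' (H1 a) (H1 b) :=
  comp (eta b) (comp (fmap F f) (inv a)).

Lemma conj_fmap_eta a b (f : hom T a b) :
  comp (conj_fmap f) (eta a) = comp (eta b) (fmap F f).
Proof. by rewrite /conj_fmap -!compA iso_invK compm1. Qed.

Lemma conj_fmap1 a : conj_fmap (idm T a) = idm T' (H1 a).
Proof. by rewrite /conj_fmap fmap1 comp1m iso_Kinv. Qed.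

Lemma conj_fmapM a b c (g : hom T b c) (f : hom T a b) :
  conj_fmap (comp g f) = comp (conj_fmap g) (conj_fmap f).
Proof.
apply: (iso_cancelr (etaI a)).
by rewrite -compA !conj_fmap_eta compA conj_fmap_eta fmapM compA.
Qed.

Definition conj_functor : functor T T' H1 := Functor conj_fmap1 conj_fmapM.

Lemma conj_fmapD a b (f g : ahom T a b) :
  fmap conj_functor (f + g : ahom T a b) =
  (fmap conj_functor f : ahom T' _ _) + fmap conj_functor g.
Proof.
rewrite /= /conj_fmap tfD.
exact: etrans (congr1 (acomp (eta b)) (acompDl (inv a) _ _)) (acompDr (eta b) _ _).
Qed.

Definition conj_om a : hom T' (H1 (Om T a)) (Om T' (H1 a)) :=
  comp (fmap (OmF T') (eta a)) (comp (tf_om F a) (inv (Om T a))).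

Lemma conj_om_iso a : is_iso (conj_om a).
Proof.
apply: iso_comp; first exact: fmap_iso.
by apply: iso_comp; [exact: tf_om_iso | exact: iso_inv_iso].
Qed.

Lemma conj_om_eta a :
  comp (conj_om a) (eta (Om T a)) = comp (fmap (OmF T') (eta a)) (tf_om F a).
Proof. by rewrite /conj_om -!compA iso_invK compm1. Qed.

Lemma conj_om_nat a b (f : hom T a b) :
  comp (conj_om b) (fmap conj_functor (fmap (OmF T) f)) =
  comp (fmap (OmF T') (fmap conj_functor f)) (conj_om a).
Proof.
apply: (iso_cancelr (etaI (Om T a))).
rewrite -[LHS]compA -[RHS]compA conj_om_eta conj_fmap_eta.
rewrite [LHS]compA [RHS]compA -fmapM conj_fmap_eta conj_om_eta.
by rewrite -[LHS]compA tf_om_nat compA -fmapM.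
Qed.

Lemma conj_dist a b c (f : hom T (Om T c) a) (g : hom T a b) (h : hom T b c)
    (f' : hom T' (Om T' (H1 c)) (H1 a)) :
  dist f g h -> comp f' (conj_om c) = fmap conj_functor f ->
  dist f' (fmap conj_functor g) (fmap conj_functor h).
Proof.
move=> fgh e; pose k := iso_inv (tf_om_iso F c).
have d : dist (comp (fmap F f) k) (fmap F g) (fmap F h).
  by apply: (tf_dist fgh); rewrite -compA iso_invK compm1.
apply: (dist_iso (etaI a) (etaI b) (etaI c) _ _ _ d).
- apply: (iso_cancelr (tf_om_iso F c)).
  rewrite -[acomp _ _]/(comp (eta a) (comp (fmap F f) k)) -!compA iso_invK compm1.
  by rewrite -conj_om_eta compA e -conj_fmap_eta.
- exact: esym (conj_fmap_eta _).
- exact: esym (conj_fmap_eta _).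
Qed.

Definition conj_trifunctor : trifunctor T T' H1 :=
  TriFunctor conj_fmapD conj_om_iso conj_om_nat conj_dist.
End Conjugation.

Section InitialTheories.
Variables (O O' : Type) (E : extcat O) (E' : extcat O').
Variables (P : functor_property E) (P' : functor_property E').
Variables (K : initial_theory P) (L : initial_theory P').

Variables (Phi0 : O -> O') (Phi : functor E E' Phi0) (exPhi : exact_functor Phi).
Variables (Psi0 : O' -> O) (Psi : functor E' E Psi0) (exPsi : exact_functor Psi).
Let JPsi := theory_precomp exPsi (jj K).
Let JPsiPhi := theory_precomp exPhi JPsi.

Lemma extends_comp (F : trifunctor (kk K) (kk L) Phi0) (F' : trifunctor (kk L) (kk K) Psi0) :
  extends_theory (jj K) (theory_precomp exPhi (jj L)) F -> extends_theory (jj L) JPsi F' ->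
  extends_theory (jj K) JPsiPhi (comp_trifunctor F' F).
Proof.
move=> [Ff Fb] [Ff' Fb']; split=> [A B f|A B C i p e] /=.
  by rewrite Ff Ff'.
by rewrite Fb fmapM Fb' -compA.
Qed.

(** The naturality of eta on algebra maps says that the conjugate of the identity
    extends the functor of the new theory; its compatibility with boundary maps
    says the same of the boundaries. *)
Lemma extends_conj eta : (theory_iso (jj K) JPsiPhi eta) ->
  forall etaI : forall a, is_iso (eta a),
  extends_theory (jj K) JPsiPhi (conj_trifunctor (id_trifunctor (kk K)) etaI).
Proof.
move=> [_ en eb] etaI; split=> [A B f|A B C i p e].
  apply: (iso_cancelr (etaI A)); rewrite [LHS](conj_fmap_eta (id_trifunctor _)).
  exact: en.
apply: (iso_cancelr (etaI (Om (kk K) C))).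
rewrite [LHS](conj_fmap_eta (id_trifunctor _)) -[RHS]compA.
apply: etrans (eb _ _ _ _ _ e) _; congr (comp (bd JPsiPhi e) _).
exact: esym (etrans (conj_om_eta (id_trifunctor _) _ C) (compm1 _)).
Qed.

(** By uniqueness F' o F is the conjugate of the identity by eta, so that eta is
    an isomorphism of triangulated functors by construction. *)
Lemma comp_natiso_id (F : trifunctor (kk K) (kk L) Phi0) (F' : trifunctor (kk L) (kk K) Psi0) eta :
  extends_theory (jj K) (theory_precomp exPhi (jj L)) F -> extends_theory (jj L) JPsi F' ->
  P JPsiPhi -> theory_iso (jj K) JPsiPhi eta ->
  tri_natiso (comp_trifunctor F' F) (id_trifunctor (kk K)).
Proof.
move=> hF hF' hP he; have [etaI _ _] := he.
have [ef eo] := jj_unique hP (extends_comp hF hF') (extends_conj he etaI).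
exists (fun a => iso_inv (etaI a)); split.
- by move=> a; exact: iso_inv_iso.
- move=> a b f; rewrite ef; apply: (iso_cancell (etaI b)).
  by rewrite compA iso_Kinv comp1m.
- move=> a; rewrite eo; apply: (iso_cancelr (etaI (Om (kk K) a))).
  rewrite -[LHS]compA iso_invK -[RHS]compA.
  apply: etrans (compm1 _) _; apply: esym.
  apply: etrans (congr1 (comp _) (etrans (conj_om_eta (id_trifunctor _) etaI a) (compm1 _))) _.
  by rewrite -fmapM iso_invK fmap1.
Qed.
End InitialTheories.
(** * Additive generators and finitely supported functions *)

Section Spans.
Variable l : comPzRingType.

(** Generation as an additive group, in the form of an induction principle. The
    formulas for products and involutions in dual crossed products only hold on
    homogeneous elements, hence the need for generators smaller than all
    elementary tensors. *)
Record spans (V : zmodType) (P : V -> Prop) : Prop := Spans {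
  span_ind : forall Q : V -> Prop, Q 0 -> (forall u v, Q u -> Q v -> Q (u + v)) ->
    (forall v, P v -> Q v) -> forall v, Q v }.

Lemma spans_all (V : zmodType) : spans (fun _ : V => True).
Proof. by apply: Spans => Q _ _ QP v; exact: QP. Qed.

Lemma spans_homogeneous (sg : conjugation l) (G : groupType) (B : gralg sg G) :
  spans (fun b : B => exists g, gdeg g b).
Proof.
apply: Spans => Q Q0 QD QP; apply: (dec_ind (gdeg_sum B) Q0 QD) => g b Db.
by apply: QP; exists g.
Qed.

Definition deltas (S : choiceType) (V : lmodType l) (P : V -> Prop) (x : fs S V) : Prop :=
  exists s v, P v /\ x = delta s v.

Lemma spans_deltas {S : choiceType} (V : lmodType l) (P : V -> Prop) :
  spans P -> spans (@deltas S V P).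
Proof.
move=> spP; apply: Spans => Q Q0 QD QP; apply: fs_ind => // s; apply: (span_ind spP) => [|u v|v Pv].
- by rewrite delta0.
- by rewrite deltaD; exact: QD.
- by apply: QP; exists s, v.
Qed.

Lemma additive0 (V W : zmodType) (f : V -> W) : {morph f : x y / x + y} -> f 0 = 0.
Proof. by move=> fD; apply: (addrI (f 0)); rewrite -fD !addr0. Qed.

Lemma linear_additive (V W : lmodType l) (f : V -> W) : linear f -> {morph f : x y / x + y}.
Proof. by move=> fL x y; have := fL 1 x y; rewrite !scale1r. Qed.

Lemma eq_on_span (V W : zmodType) (P : V -> Prop) (f g : V -> W) : spans P ->
  {morph f : x y / x + y} -> {morph g : x y / x + y} -> (forall v, P v -> f v = g v) -> f =1 g.
Proof.
move=> spP fD gD; apply: (span_ind spP) => [|u v eu ev]; first by rewrite !additive0.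
by rewrite fD gD eu ev.
Qed.

Lemma star_hom_on_span (sg : conjugation l) (A B : staralg sg) (P : A -> Prop) (f : A -> B) :
  spans P -> linear f ->
  (forall a b, P a -> P b -> f (smul a b) = smul (f a) (f b)) ->
  (forall a, P a -> f (star a) = star (f a)) -> is_star_hom f.
Proof.
move=> spP fL fM fS; have fD := linear_additive fL; split=> // [a b|].
  move: a; apply: (eq_on_span spP) => [a a'|a a'|a Pa].
  - by rewrite smulDl fD.
  - by rewrite fD smulDl.
  move: b; apply: (eq_on_span spP) => [b b'|b b'|b Pb]; last exact: fM.
  - by rewrite smulDr fD.
  - by rewrite fD smulDr.
apply: (eq_on_span spP) => // a a'.
- by rewrite starD fD.
- by rewrite fD starD.
Qed.

End Spans.

Section BilinearExtension.
Variables (l : comPzRingType) (S T : choiceType) (A : lmodType l).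

Definition lext2 (W : zmodType) (phi : S -> T -> A -> W) : fs S (fs T A) -> W :=
  lext (fun s => lext (phi s)).

Section Additive.
Variables (W : zmodType) (phi : S -> T -> A -> W).
Hypothesis phiD : forall s t, {morph phi s t : a b / a + b}.

Lemma lext2D : {morph lext2 phi : x y / x + y}.
Proof. by apply: lextD => s; apply: lextD. Qed.

Lemma lext2_delta s t a : lext2 phi (delta s (delta t a)) = phi s t a.
Proof. by rewrite /lext2 !lext_delta // => u; apply: lextD. Qed.
End Additive.

Lemma lext2_linear (W : lmodType l) (phi : S -> T -> A -> W) :
  (forall s t, linear (phi s t)) -> linear (lext2 phi).
Proof.
move=> phiL; have phiD s t := linear_additive (phiL s t).
have phiZ s t c a : phi s t (c *: a) = c *: phi s t a.
  by have := phiL s t c a 0; rewrite (additive0 (phiD s t)) !addr0.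
move=> c x y; rewrite (lext2D phiD); congr (_ + _); apply: (lextZ (sg := id)) => [s|s d z].
  exact: lextD.
by apply: (lextZ (sg := id)).
Qed.

End BilinearExtension.

Section Reindexing.
Variables (l : comPzRingType) (A : lmodType l).

Lemma delta2_linear (S T : choiceType) (s : S) (t : T) :
  linear (fun a : A => delta s (delta t a)).
Proof. by move=> c a b; rewrite !deltaD !deltaZ. Qed.

Variables (S T S' T' : choiceType) (w1 : S -> T -> S') (w2 : S -> T -> T').

Definition reindex2 : fs S (fs T A) -> fs S' (fs T' A) :=
  lext2 (fun s t a => delta (w1 s t) (delta (w2 s t) a)).

Lemma reindex2_linear : linear reindex2.
Proof. by apply: lext2_linear => s t; exact: delta2_linear. Qed.

Definition reindex2D := linear_additive reindex2_linear.

Lemma reindex2_delta s t a :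
  reindex2 (delta s (delta t a)) = delta (w1 s t) (delta (w2 s t) a).
Proof. by apply: lext2_delta => {}s {}t x y; rewrite !deltaD. Qed.
End Reindexing.

Lemma reindex2K (l : comPzRingType) (A : lmodType l) (S T S' T' : choiceType)
    (w1 : S -> T -> S') (w2 : S -> T -> T') (v1 : S' -> T' -> S) (v2 : S' -> T' -> T) :
  (forall s t, v1 (w1 s t) (w2 s t) = s) -> (forall s t, v2 (w1 s t) (w2 s t) = t) ->
  cancel (@reindex2 l A S T S' T' w1 w2) (reindex2 v1 v2).
Proof.
move=> e1 e2; pose f := reindex2 v1 v2 \o @reindex2 l A S T S' T' w1 w2.
apply: (eq_on_span (spans_deltas (spans_deltas (@spans_all A))) (f := f) (g := id)) => //.
  by move=> x y; rewrite /f /= !reindex2D.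
move=> _ [s [_ [[t [a [_ ->]]] ->]]].
by rewrite /f /= !reindex2_delta e1 e2.
Qed.

Section Pointwise.
Variables (l : comPzRingType) (S : choiceType).

Lemma fsmap_idE (A B : lmodType l) (f : A -> B) (x : fs S A) s :
  {morph f : a b / a + b} -> fsmap id f x s = f (x s).
Proof. by move=> fD; apply: (fsmapE fD). Qed.

Lemma fsmap_linear (T : choiceType) (A B : lmodType l) (u : S -> T) (f : A -> B) :
  linear f -> linear (fsmap u f).
Proof.
move=> fL; have fD := linear_additive fL.
have fZ c a : f (c *: a) = c *: f a by have := fL c a 0; rewrite (additive0 fD) !addr0.
move=> c x y; rewrite (fsmapD _ fD); congr (_ + _).
apply: (lextZ (sg := id)) => [s a b|s d a]; first by rewrite fD deltaD.
by rewrite fZ deltaZ.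
Qed.

(** Applying a map coefficientwise is the functor - (x) l^(S), and l^(S) is free. *)
Lemma fsmap_exact (A B C : lmodType l) (i : A -> B) (p : B -> C) (s : C -> B) :
  {morph i : a b / a + b} -> {morph p : a b / a + b} -> {morph s : a b / a + b} ->
  injective i -> range i = [set b | p b = 0] -> cancel s p ->
  [/\ injective (fsmap id i : fs S A -> fs S B),
      range (fsmap id i : fs S A -> fs S B) = [set y | fsmap id p y = 0]
    & range (fsmap id p : fs S B -> fs S C) = [set: fs S C]].
Proof.
move=> iD pD sD iI ip sK; split.
- move=> x y e; apply: fs_eqP => t; apply: iI.
  by rewrite -!(fsmap_idE _ _ iD) e.
- apply/seteqP; split=> [_ [x _ <-]|y /= py0].
    apply: fs_eqP => t; rewrite !fsmap_idE //.
    have : range i (i (x t)) by exists (x t).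
    by rewrite ip.
  have pre t : exists a, i a = y t.
    have : range i (y t) by rewrite ip /= -(fsmap_idE y t pD) py0.
    by case=> a _ e; exists a.
  pose h t := projT1 (cid (pre t)).
  have hE t : i (h t) = y t by rewrite /h; case: cid.
  have hfs : h \in @fs_pred l S A.
    apply/asboolP; apply: (sub_finite_set _ (fs_finite y)) => t /= ht yt; apply: ht.
    by apply: iI; rewrite hE yt (additive0 iD).
  by exists (FS hfs) => //; apply: fs_eqP => t; rewrite fsmap_idE //= hE.
- apply/seteqP; split=> // z _; exists (fsmap id s z) => //.
  by apply: fs_eqP => t; rewrite !fsmap_idE.
Qed.
End Pointwise.
(** * Computation on generators *)

Section GeneratorRules.
Variables (l : comPzRingType) (sg : conjugation l) (G : groupType).

Section Equivariant.
Variable A : galg sg G.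

Lemma gmx_smul (X : gset G) p a q b :
  @smul l sg (gmx X A) (delta p a) (delta q b) =
  if p.2 == q.1 then delta (p.1, q.2) (smul a b) else 0.
Proof. exact: (fsmul_delta (mx_laws X A)). Qed.

Lemma gmx_star (X : gset G) p a :
  @star l sg (gmx X A) (delta p a) = delta (p.2, p.1) (star a).
Proof. exact: (fsstar_delta (mx_laws X A)). Qed.

Lemma gmx_act_delta (X : gset G) g p a :
  @gact l sg G (gmx X A) g (delta p a) = delta (gsact g p.1, gsact g p.2) (gact g a).
Proof. by apply: fsmap_delta; exact: gactD. Qed.

Lemma gpl_smul m a n b :
  @smul l sg (gpl A) (delta m a) (delta n b) = delta (m + n)%N (smul a b).
Proof. exact: (fsmul_delta (pl_laws A)). Qed.

Lemma gpl_star m a : @star l sg (gpl A) (delta m a) = delta m (star a).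
Proof. exact: (fsstar_delta (pl_laws A)). Qed.

Lemma gpl_act_delta g n a : @gact l sg G (gpl A) g (delta n a) = delta n (gact g a).
Proof. by apply: fsmap_delta; exact: gactD. Qed.

Lemma gpm_smul p a q b :
  @smul l sg (gpm A) (delta p a) (delta q b) =
  if p.2 == q.1 then delta (p.1, q.2) (smul a b) else 0.
Proof. exact: (fsmul_delta (pm_laws A)). Qed.

Lemma gpm_star p a : @star l sg (gpm A) (delta p a) = pm_gs p a.
Proof. exact: (fsstar_delta (pm_laws A)). Qed.

Lemma gpm_act_delta g p a : @gact l sg G (gpm A) g (delta p a) = delta p (gact g a).
Proof. by apply: fsmap_delta; exact: gactD. Qed.

Lemma crossed_smul g a h b :
  @smul l sg (crossed A) (delta g a) (delta h b) = delta (g * h)%g (smul a (gact g b)).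
Proof. exact: (fsmul_delta (cp_laws A)). Qed.

Lemma crossed_star g a :
  @star l sg (crossed A) (delta g a) = delta g^-1%g (gact g^-1%g (star a)).
Proof. exact: (fsstar_delta (cp_laws A)). Qed.
End Equivariant.

Section Graded.
Variable B : gralg sg G.

Lemma grmx_smul (X : grset G) p a q b :
  @smul l sg (grmx X B) (delta p a) (delta q b) =
  if p.2 == q.1 then delta (p.1, q.2) (smul a b) else 0.
Proof. exact: (fsmul_delta (mx_laws X B)). Qed.

Lemma grmx_star (X : grset G) p a :
  @star l sg (grmx X B) (delta p a) = delta (p.2, p.1) (star a).
Proof. exact: (fsstar_delta (mx_laws X B)). Qed.

Lemma grpl_smul m a n b :
  @smul l sg (grpl B) (delta m a) (delta n b) = delta (m + n)%N (smul a b).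
Proof. exact: (fsmul_delta (pl_laws B)). Qed.

Lemma grpl_star m a : @star l sg (grpl B) (delta m a) = delta m (star a).
Proof. exact: (fsstar_delta (pl_laws B)). Qed.

Lemma grpm_smul p a q b :
  @smul l sg (grpm B) (delta p a) (delta q b) =
  if p.2 == q.1 then delta (p.1, q.2) (smul a b) else 0.
Proof. exact: (fsmul_delta (pm_laws B)). Qed.

Lemma grpm_star p a : @star l sg (grpm B) (delta p a) = pm_gs p a.
Proof. exact: (fsstar_delta (pm_laws B)). Qed.

Lemma dual_smul g h k b c : gdeg k b ->
  @smul l sg (dual_crossed B) (delta g b) (delta h c) =
  if h == (g * k)%g then delta g (smul b c) else 0.
Proof. by move=> Db; rewrite -(dp_gmE _ _ _ Db); exact: (fsmul_delta (dp_laws B)). Qed.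

Lemma dual_star g k b : gdeg k b ->
  @star l sg (dual_crossed B) (delta g b) = delta (g * k)%g (star b).
Proof. by move=> Db; rewrite -(dp_gsE _ Db); exact: (fsstar_delta (dp_laws B)). Qed.

Lemma dual_act_delta h g b :
  @gact l sg G (dual_crossed B) h (delta g b) = delta (h * g)%g b.
Proof. by apply: fsmap_delta. Qed.
End Graded.
End GeneratorRules.

Section AlgebraSpans.
Variables (l : comPzRingType) (sg : conjugation l) (G : groupType).

Section Equivariant.
Variables (A : galg sg G) (P : A -> Prop) (spP : spans P).

Lemma gmx_spans (X : gset G) : @spans (gmx X A) (@deltas l (X * X)%type A P).
Proof. exact: spans_deltas spP. Qed.

Lemma gpl_spans : @spans (gpl A) (@deltas l nat A P).
Proof. exact: spans_deltas spP. Qed.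

Lemma gpm_spans : @spans (gpm A) (@deltas l (bool * bool)%type A P).
Proof. exact: spans_deltas spP. Qed.

Lemma crossed_spans : @spans (crossed A) (@deltas l G A P).
Proof. exact: spans_deltas spP. Qed.
End Equivariant.

Section Graded.
Variables (B : gralg sg G) (P : B -> Prop) (spP : spans P).

Lemma grmx_spans (X : grset G) : @spans (grmx X B) (@deltas l (X * X)%type B P).
Proof. exact: spans_deltas spP. Qed.

Lemma grpl_spans : @spans (grpl B) (@deltas l nat B P).
Proof. exact: spans_deltas spP. Qed.

Lemma grpm_spans : @spans (grpm B) (@deltas l (bool * bool)%type B P).
Proof. exact: spans_deltas spP. Qed.

Lemma dual_spans : @spans (dual_crossed B) (@deltas l G B P).
Proof. exact: spans_deltas spP. Qed.
End Graded.
End AlgebraSpans.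

Section InverseHomomorphisms.
Variables (l : comPzRingType) (sg : conjugation l) (G : groupType).

Lemma inverse_star_hom (A B : staralg sg) (f : A -> B) (g : B -> A) :
  cancel f g -> cancel g f -> is_star_hom f -> is_star_hom g.
Proof.
move=> fK gK hf; split=> [c a b|a b|a]; apply: (can_inj fK); rewrite gK.
- by rewrite (shL hf) !gK.
- by rewrite (shM hf) !gK.
- by rewrite (shS hf) !gK.
Qed.

Lemma galg_iso (A B : galg sg G) (f : galg_hom A B) (g : B -> A) :
  cancel f g -> cancel g f -> is_iso (f : hom (galg_cat sg G) A B).
Proof.
move=> fK gK.
have gA k b : g (gact k b) = gact k (g b) by rewrite -{1}[b]gK -galg_fun_act fK.
exists (GAlgHom (inverse_star_hom fK gK (galg_funP f)) gA).
by split; apply: galg_hom_eq => x; [exact: fK | exact: gK].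
Qed.

(** The inverse preserves degrees because f commutes with taking homogeneous
    components. *)
Lemma gralg_iso (A B : gralg sg G) (f : gralg_hom A B) (g : B -> A) :
  cancel f g -> cancel g f -> is_iso (f : hom (gralg_cat sg G) A B).
Proof.
move=> fK gK.
have gA k b : gdeg k b -> gdeg k (g b).
  move=> Db; suff <- : dec (gdeg_sum A) (g b) k = g b by exact: dec_in.
  by apply: (can_inj fK); rewrite gralg_fun_dec gK (dec_hom _ Db) deltaE eqxx.
exists (GrAlgHom (inverse_star_hom fK gK (gralg_funP f)) gA).
by split; apply: gralg_hom_eq => x; [exact: fK | exact: gK].
Qed.

Lemma galg_hom_eq_on_span (A B : galg sg G) (P : A -> Prop) (f h : galg_hom A B) :
  spans P -> (forall a, P a -> f a = h a) -> f = h.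
Proof.
move=> spP e; apply: galg_hom_eq; apply: (eq_on_span spP) => //.
  exact: shD (galg_funP f).
exact: shD (galg_funP h).
Qed.

Lemma gralg_hom_eq_on_span (A B : gralg sg G) (P : A -> Prop) (f h : gralg_hom A B) :
  spans P -> (forall a, P a -> f a = h a) -> f = h.
Proof.
move=> spP e; apply: gralg_hom_eq; apply: (eq_on_span spP) => //.
  exact: shD (gralg_funP f).
exact: shD (gralg_funP h).
Qed.

Lemma act_on_span (A B : galg sg G) (P : A -> Prop) (f : A -> B) : spans P ->
  {morph f : x y / x + y} -> (forall g a, P a -> f (gact g a) = gact g (f a)) ->
  forall g a, f (gact g a) = gact g (f a).
Proof.
move=> spP fD fP g; apply: (eq_on_span spP) => [x y|x y|]; last exact: fP.
  by rewrite gactD fD.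
by rewrite fD gactD.
Qed.

Lemma crossed_deg_on_span (A : galg sg G) (B : gralg sg G) (P : A -> Prop)
    (f : crossed A -> B) : spans P -> {morph f : x y / x + y} ->
  (forall g a, P a -> gdeg g (f (delta g a))) ->
  forall g x, gdeg g x -> gdeg g (f x).
Proof.
move=> spP fD fP g _ [a ->]; move: a; apply: (span_ind spP) => [|u v Du Dv|v Pv]; last exact: fP.
  by rewrite delta0 (additive0 fD); exact: (ds0 (gdeg_sum B)).
by rewrite deltaD fD; exact: (dsD (gdeg_sum B)).
Qed.
End InverseHomomorphisms.

(** * Crossed products of polynomials and matrices *)

Section CrossedOfConstructions.
Variables (l : comPzRingType) (sg : conjugation l) (G : groupType) (A : galg sg G).

Let allA : spans (fun _ : A => True) := spans_all A.

Definition crossed_pl_fun : crossed (gpl A) -> grpl (crossed A) :=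
  reindex2 (fun g n => n) (fun g n => g).

Lemma crossed_pl_hom : is_star_hom crossed_pl_fun.
Proof.
apply: (star_hom_on_span (crossed_spans (gpl_spans allA))); first exact: reindex2_linear.
  move=> _ _ [g [_ [[m [a [_ ->]]] ->]]] [h [_ [[n [b [_ ->]]] ->]]].
  rewrite crossed_smul gpl_act_delta gpl_smul /crossed_pl_fun !reindex2_delta.
  by rewrite grpl_smul crossed_smul.
move=> _ [g [_ [[m [a [_ ->]]] ->]]].
rewrite crossed_star gpl_star gpl_act_delta /crossed_pl_fun !reindex2_delta.
by rewrite grpl_star crossed_star.
Qed.

Lemma crossed_pl_deg g x : gdeg g x -> gdeg g (crossed_pl_fun x).
Proof.
move: g x; apply: (crossed_deg_on_span (gpl_spans allA)); first exact: reindex2D.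
move=> g _ [n [a [_ ->]]]; rewrite /crossed_pl_fun reindex2_delta.
by apply: fs_deg_delta => [_|]; [exact: gdeg_sum | exists a].
Qed.

Definition crossed_pl : gralg_hom (crossed (gpl A)) (grpl (crossed A)) :=
  GrAlgHom crossed_pl_hom crossed_pl_deg.

Lemma crossed_pl_iso : is_iso (crossed_pl : hom (gralg_cat sg G) _ _).
Proof.
apply: (gralg_iso (f := crossed_pl) (g := reindex2 (fun n g => g) (fun n g => n))).
  exact: reindex2K.
exact: reindex2K.
Qed.

Lemma crossed_pl_const :
  gralg_comp crossed_pl (crossed_map (gpl_const A)) = grpl_const (crossed A).
Proof.
apply: (gralg_hom_eq_on_span (crossed_spans allA)) => _ [g [a [_ ->]]] /=.
rewrite fsmap_delta; last exact: deltaD.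
exact: reindex2_delta.
Qed.

Definition crossed_pm_fun : crossed (gpm A) -> grpm (crossed A) :=
  reindex2 (fun g p => p) (fun g p => g).

Lemma crossed_pm_hom : is_star_hom crossed_pm_fun.
Proof.
apply: (star_hom_on_span (crossed_spans (gpm_spans allA))); first exact: reindex2_linear.
  move=> _ _ [g [_ [[p [a [_ ->]]] ->]]] [h [_ [[q [b [_ ->]]] ->]]].
  rewrite crossed_smul gpm_act_delta gpm_smul /crossed_pm_fun !reindex2_delta grpm_smul.
  case: eqP => _; first by rewrite reindex2_delta crossed_smul.
  by rewrite delta0 (additive0 (reindex2D _ _)).
move=> _ [g [_ [[p [a [_ ->]]] ->]]].
rewrite crossed_star gpm_star /pm_gs gpm_act_delta /crossed_pm_fun !reindex2_delta.
by rewrite grpm_star /pm_gs crossed_star (shZ (gact_hom A _)) -deltaZ.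
Qed.

Lemma crossed_pm_deg g x : gdeg g x -> gdeg g (crossed_pm_fun x).
Proof.
move: g x; apply: (crossed_deg_on_span (gpm_spans allA)); first exact: reindex2D.
move=> g _ [p [a [_ ->]]]; rewrite /crossed_pm_fun reindex2_delta.
by apply: fs_deg_delta => [_|]; [exact: gdeg_sum | exists a].
Qed.

Definition crossed_pm : gralg_hom (crossed (gpm A)) (grpm (crossed A)) :=
  GrAlgHom crossed_pm_hom crossed_pm_deg.

Lemma crossed_pm_iso : is_iso (crossed_pm : hom (gralg_cat sg G) _ _).
Proof.
apply: (gralg_iso (f := crossed_pm) (g := reindex2 (fun p g => g) (fun p g => p))).
  exact: reindex2K.
exact: reindex2K.
Qed.

Lemma crossed_pm_corner :
  gralg_comp crossed_pm (crossed_map (gpm_corner A)) = grpm_corner (crossed A).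
Proof.
apply: (gralg_hom_eq_on_span (crossed_spans allA)) => _ [g [a [_ ->]]] /=.
rewrite fsmap_delta; last exact: deltaD.
exact: reindex2_delta.
Qed.

Section Matrices.
Variables (X : gset G) (d : X -> G) (d1 : forall x, d x = 1%g).

(** The twist of the column index by g^-1 absorbs the action of G on X. The set X
    is given degrees [d] equal to 1 only propositionally because the degrees of
    a disjoint union of trivially graded sets are not convertible to the
    constant function. *)
Definition crossed_mx_fun : crossed (gmx X A) -> grmx (GrSet d) (crossed A) :=
  reindex2 (fun g p => (p.1, gsact g^-1%g p.2)) (fun g p => g).

Lemma crossed_mx_hom : is_star_hom crossed_mx_fun.
Proof.
apply: (star_hom_on_span (crossed_spans (gmx_spans allA X))); first exact: reindex2_linear.
  move=> _ _ [g [_ [[p [a [_ ->]]] ->]]] [h [_ [[q [b [_ ->]]] ->]]].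
  rewrite crossed_smul gmx_act_delta gmx_smul /crossed_mx_fun !reindex2_delta grmx_smul.
  rewrite crossed_smul /=.
  rewrite -[gsact g^-1 p.2 == _](inj_eq (@gsact_inj _ X g)) -gsactM mulgV gsact1.
  case: eqP => _; last by rewrite delta0 (additive0 (reindex2D _ _)).
  by rewrite reindex2_delta /= -gsactM invgM mulgVK.
move=> _ [g [_ [[p [a [_ ->]]] ->]]].
rewrite crossed_star gmx_star gmx_act_delta /crossed_mx_fun !reindex2_delta.
by rewrite grmx_star crossed_star /= -gsactM invgK mulgV gsact1.
Qed.

Lemma crossed_mx_deg g x : gdeg g x -> gdeg g (crossed_mx_fun x).
Proof.
move: g x; apply: (crossed_deg_on_span (gmx_spans allA X)); first exact: reindex2D.
move=> g _ [[x y] [a [_ ->]]]; rewrite /crossed_mx_fun reindex2_delta.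
have Da : gdeg g (delta g a : crossed A) by exists a.
have := @grmx_deg_delta _ _ _ (GrSet d) _ _ x (gsact g^-1%g y) _ Da.
by rewrite /= !d1 invg1 mul1g mulg1.
Qed.

Definition crossed_mx : gralg_hom (crossed (gmx X A)) (grmx (GrSet d) (crossed A)) :=
  GrAlgHom crossed_mx_hom crossed_mx_deg.

Lemma crossed_mx_iso : is_iso (crossed_mx : hom (gralg_cat sg G) _ _).
Proof.
apply: (gralg_iso (f := crossed_mx)
  (g := reindex2 (fun p g => g) (fun p g => (p.1, gsact g p.2)))).
  by apply: reindex2K => // g [x y] /=; rewrite -gsactM mulgV gsact1.
by apply: reindex2K => // -[x y] g /=; rewrite -gsactM mulVg gsact1.
Qed.
End Matrices.

Lemma crossed_mx_corner (X : choiceType) (x : X) :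
  gralg_comp (@crossed_mx (triv_gset G X) (fun _ => 1%g) (fun _ => erefl))
    (crossed_map (gmx_corner A x)) = grmx_corner (crossed A) x.
Proof.
apply: (gralg_hom_eq_on_span (crossed_spans allA)) => _ [g [a [_ ->]]] /=.
rewrite fsmap_delta; last exact: deltaD.
exact: reindex2_delta.
Qed.

Lemma crossed_mx_inl (X Y : gset G) :
  gralg_comp (@crossed_mx (sum_gset X Y)
      (@grset_deg G (sum_grset (triv_grset G X) (triv_grset G Y)))
      (fun z => match z with inl _ => erefl | inr _ => erefl end))
    (crossed_map (gmx_inl A X Y)) =
  gralg_comp (grmx_inl (crossed A) (triv_grset G X) (triv_grset G Y))
    (@crossed_mx X (fun _ => 1%g) (fun _ => erefl)).
Proof.
apply: (gralg_hom_eq_on_span (crossed_spans (gmx_spans allA X))).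
move=> _ [g [_ [[p [a [_ ->]]] ->]]] /=.
rewrite /crossed_mx_fun !reindex2_delta fsmap_delta; last exact: fsmapD.
by rewrite /mx_inl !fsmap_delta // reindex2_delta.
Qed.

End CrossedOfConstructions.
(** * Dual crossed products of polynomials and matrices *)

Section DualOfConstructions.
Variables (l : comPzRingType) (sg : conjugation l) (G : groupType) (B : gralg sg G).

Let homB := spans_homogeneous B.

Lemma grpl_deg_delta k n b : gdeg k b -> gdeg k (delta n b : grpl B).
Proof. by apply: fs_deg_delta => _; exact: gdeg_sum. Qed.

Lemma grpm_deg_delta k p b : gdeg k b -> gdeg k (delta p b : grpm B).
Proof. by apply: fs_deg_delta => _; exact: gdeg_sum. Qed.

Lemma grmx_gdeg_delta (X : grset G) k (x y : X) b : gdeg k b ->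
  gdeg (grset_deg x * k * (grset_deg y)^-1)%g (delta (x, y) b : grmx X B).
Proof. exact: grmx_deg_delta. Qed.

Definition dual_pl_fun : dual_crossed (grpl B) -> gpl (dual_crossed B) :=
  reindex2 (fun g n => n) (fun g n => g).

Lemma dual_pl_hom : is_star_hom dual_pl_fun.
Proof.
apply: (star_hom_on_span (dual_spans (grpl_spans homB))); first exact: reindex2_linear.
  move=> _ _ [g [_ [[m [b [[k Db] ->]]] ->]]] [h [_ [[n [c [_ ->]]] ->]]].
  rewrite (dual_smul _ _ _ (grpl_deg_delta _ Db)) grpl_smul /dual_pl_fun !reindex2_delta.
  rewrite gpl_smul (dual_smul _ _ _ Db); case: eqP => _; first by rewrite reindex2_delta.
  by rewrite delta0 (additive0 (reindex2D _ _)).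
move=> _ [g [_ [[m [b [[k Db] ->]]] ->]]].
rewrite (dual_star _ (grpl_deg_delta _ Db)) grpl_star /dual_pl_fun !reindex2_delta.
by rewrite gpl_star (dual_star _ Db).
Qed.

Lemma dual_pl_act g x : dual_pl_fun (gact g x) = gact g (dual_pl_fun x).
Proof.
move: g x; apply: (act_on_span (dual_spans (grpl_spans homB))); first exact: reindex2D.
move=> h _ [g [_ [[n [b [_ ->]]] ->]]].
by rewrite dual_act_delta /dual_pl_fun !reindex2_delta gpl_act_delta dual_act_delta.
Qed.

Definition dual_pl : galg_hom (dual_crossed (grpl B)) (gpl (dual_crossed B)) :=
  GAlgHom dual_pl_hom dual_pl_act.

Lemma dual_pl_iso : is_iso (dual_pl : hom (galg_cat sg G) _ _).
Proof.
apply: (galg_iso (f := dual_pl) (g := reindex2 (fun n g => g) (fun n g => n))).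
  exact: reindex2K.
exact: reindex2K.
Qed.

Lemma dual_pl_const :
  galg_comp dual_pl (dual_crossed_map (grpl_const B)) = gpl_const (dual_crossed B).
Proof.
apply: (galg_hom_eq_on_span (dual_spans (spans_all B))) => _ [g [b [_ ->]]] /=.
rewrite fsmap_delta; last exact: deltaD.
exact: reindex2_delta.
Qed.

Definition dual_pm_fun : dual_crossed (grpm B) -> gpm (dual_crossed B) :=
  reindex2 (fun g p => p) (fun g p => g).

Lemma dual_pm_hom : is_star_hom dual_pm_fun.
Proof.
apply: (star_hom_on_span (dual_spans (grpm_spans homB))); first exact: reindex2_linear.
  move=> _ _ [g [_ [[p [b [[k Db] ->]]] ->]]] [h [_ [[q [c [_ ->]]] ->]]].
  rewrite (dual_smul _ _ _ (grpm_deg_delta _ Db)) grpm_smul /dual_pm_fun !reindex2_delta.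
  rewrite gpm_smul (dual_smul _ _ _ Db).
  case: (p.2 =P q.1) => _; last first.
    by rewrite !delta0; case: ifP => _; rewrite (additive0 (reindex2D _ _)).
  case: eqP => _; first by rewrite reindex2_delta.
  by rewrite delta0 (additive0 (reindex2D _ _)).
move=> _ [g [_ [[p [b [[k Db] ->]]] ->]]].
rewrite (dual_star _ (grpm_deg_delta _ Db)) grpm_star /pm_gs /dual_pm_fun !reindex2_delta.
by rewrite gpm_star /pm_gs (dual_star _ Db) -deltaZ.
Qed.

Lemma dual_pm_act g x : dual_pm_fun (gact g x) = gact g (dual_pm_fun x).
Proof.
move: g x; apply: (act_on_span (dual_spans (grpm_spans homB))); first exact: reindex2D.
move=> h _ [g [_ [[p [b [_ ->]]] ->]]].
by rewrite dual_act_delta /dual_pm_fun !reindex2_delta gpm_act_delta dual_act_delta.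
Qed.

Definition dual_pm : galg_hom (dual_crossed (grpm B)) (gpm (dual_crossed B)) :=
  GAlgHom dual_pm_hom dual_pm_act.

Lemma dual_pm_iso : is_iso (dual_pm : hom (galg_cat sg G) _ _).
Proof.
apply: (galg_iso (f := dual_pm) (g := reindex2 (fun p g => g) (fun p g => p))).
  exact: reindex2K.
exact: reindex2K.
Qed.

Lemma dual_pm_corner :
  galg_comp dual_pm (dual_crossed_map (grpm_corner B)) = gpm_corner (dual_crossed B).
Proof.
apply: (galg_hom_eq_on_span (dual_spans (spans_all B))) => _ [g [b [_ ->]]] /=.
rewrite fsmap_delta; last exact: deltaD.
exact: reindex2_delta.
Qed.

Section Matrices.
Variables (X : gset G) (d : X -> G) (actX : forall g (x : X), gsact g x = x).

(** The shift of chi_g to chi_{g|x|} absorbs the degrees of X. *)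
Definition dual_mx_fun : dual_crossed (grmx (GrSet d) B) -> gmx X (dual_crossed B) :=
  reindex2 (fun g p => p) (fun g p => (g * d p.1)%g).

Lemma dual_mx_hom : is_star_hom dual_mx_fun.
Proof.
apply: (star_hom_on_span (dual_spans (grmx_spans homB (GrSet d)))).
- exact: reindex2_linear.
- move=> _ _ [g [_ [[[x y] [b [[k Db] ->]]] ->]]] [h [_ [[[z w] [c [_ ->]]] ->]]].
  rewrite (dual_smul _ _ _ (@grmx_gdeg_delta (GrSet d) _ x y _ Db)) grmx_smul.
  rewrite /dual_mx_fun !reindex2_delta gmx_smul (dual_smul _ _ _ Db) /=.
  rewrite !mulgA -[h == _](inj_eq (mulIg (d y))) mulgVK.
  case: (y =P z) => [<-|_]; last first.
    by rewrite !delta0; case: ifP => _; rewrite (additive0 (reindex2D _ _)).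
  case: eqP => _; first by rewrite reindex2_delta.
  by rewrite delta0 (additive0 (reindex2D _ _)).
- move=> _ [g [_ [[[x y] [b [[k Db] ->]]] ->]]].
  rewrite (dual_star _ (@grmx_gdeg_delta (GrSet d) _ x y _ Db)) grmx_star.
  rewrite /dual_mx_fun !reindex2_delta gmx_star (dual_star _ Db) /=.
  by rewrite !mulgA mulgVK.
Qed.

Lemma dual_mx_act g x : dual_mx_fun (gact g x) = gact g (dual_mx_fun x).
Proof.
move: g x; apply: (act_on_span (dual_spans (grmx_spans homB (GrSet d)))).
  exact: reindex2D.
move=> h _ [g [_ [[[x y] [b [_ ->]]] ->]]].
rewrite dual_act_delta /dual_mx_fun !reindex2_delta gmx_act_delta dual_act_delta !actX.
by rewrite mulgA.
Qed.

Definition dual_mx : galg_hom (dual_crossed (grmx (GrSet d) B)) (gmx X (dual_crossed B)) :=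
  GAlgHom dual_mx_hom dual_mx_act.

Lemma dual_mx_iso : is_iso (dual_mx : hom (galg_cat sg G) _ _).
Proof.
apply: (galg_iso (f := dual_mx)
  (g := reindex2 (fun p g => (g * (d p.1)^-1)%g) (fun p g => p))).
  by apply: reindex2K => // g [x y] /=; rewrite mulgK.
by apply: reindex2K => // -[x y] g /=; rewrite mulgVK.
Qed.
End Matrices.

Lemma dual_mx_corner (X : choiceType) (x : X) :
  galg_comp (@dual_mx (triv_gset G X) (fun _ => 1%g) (fun _ _ => erefl))
    (dual_crossed_map (grmx_corner B x)) = gmx_corner (dual_crossed B) x.
Proof.
apply: (galg_hom_eq_on_span (dual_spans (spans_all B))) => _ [g [b [_ ->]]] /=.
rewrite fsmap_delta; last exact: deltaD.
by rewrite [LHS]reindex2_delta mulg1.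
Qed.

Lemma dual_mx_inl (X Y : choiceType) (dX : X -> G) (dY : Y -> G) :
  galg_comp (@dual_mx (sum_gset (triv_gset G X) (triv_gset G Y))
      (@grset_deg G (sum_grset (GrSet dX) (GrSet dY)))
      (fun _ z => match z with inl _ => erefl | inr _ => erefl end))
    (dual_crossed_map (grmx_inl B (GrSet dX) (GrSet dY))) =
  galg_comp (gmx_inl (dual_crossed B) (triv_gset G X) (triv_gset G Y))
    (@dual_mx (triv_gset G X) dX (fun _ _ => erefl)).
Proof.
apply: (galg_hom_eq_on_span (dual_spans (grmx_spans (spans_all B) (GrSet dX)))).
move=> _ [g [_ [[p [b [_ ->]]] ->]]] /=.
rewrite /dual_mx_fun !reindex2_delta fsmap_delta; last exact: fsmapD.
by rewrite /mx_inl !fsmap_delta // reindex2_delta.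
Qed.

End DualOfConstructions.

(** * Imai-Takai duality *)

Section TakaiEquivariant.
Variables (l : comPzRingType) (sg : conjugation l) (G : groupType).

Definition regular_gset : gset G :=
  @GSet G G (fun g h => (g * h)%g) (@mul1g G) (fun g h x => esym (mulgA g h x)).

Variable A : galg sg G.

(** The elements chi_g |x (a x| h) multiply like multiples of the matrix units
    e_{g,gh}; letting g act on the coefficients makes the map equivariant for
    the translation action on indices. *)
Definition takai_fun : dual_crossed (crossed A) -> gmx regular_gset A :=
  lext2 (fun g h a => delta (g, (g * h)%g) (gact g a)).

Lemma takai_fun_linear : linear takai_fun.
Proof.
by apply: lext2_linear => g h c a b; rewrite (shL (gact_hom A g)) deltaD deltaZ.
Qed.

Definition takai_funD := linear_additive takai_fun_linear.

Lemma takai_fun_delta g h a :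
  takai_fun (delta g (delta h a)) = delta (g, (g * h)%g) (gact g a).
Proof. by apply: lext2_delta => {}g {}h a' b; rewrite gactD deltaD. Qed.

Let gens := dual_spans (crossed_spans (spans_all A)).

Lemma crossed_deg_delta h (a : A) : gdeg h (delta h a : crossed A).
Proof. by exists a. Qed.

Lemma takai_hom : is_star_hom takai_fun.
Proof.
apply: (star_hom_on_span gens); first exact: takai_fun_linear.
  move=> _ _ [g [_ [[h [a [_ ->]]] ->]]] [g' [_ [[h' [b [_ ->]]] ->]]].
  rewrite (dual_smul _ _ _ (crossed_deg_delta h a)) crossed_smul !takai_fun_delta.
  rewrite gmx_smul [_ == g']eq_sym.
  case: eqP => [->|_]; last by rewrite (additive0 takai_funD).
  by rewrite takai_fun_delta (shM (gact_hom A _)) gactM mulgA.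
move=> _ [g [_ [[h [a [_ ->]]] ->]]].
rewrite (dual_star _ (crossed_deg_delta h a)) crossed_star !takai_fun_delta gmx_star.
by rewrite mulgK -gactM mulgK (shS (gact_hom A g)).
Qed.

Lemma takai_act k x : takai_fun (gact k x) = gact k (takai_fun x).
Proof.
move: k x; apply: (act_on_span gens); first exact: takai_funD.
move=> k _ [g [_ [[h [a [_ ->]]] ->]]].
by rewrite dual_act_delta !takai_fun_delta gmx_act_delta /= gactM mulgA.
Qed.

Definition takai : galg_hom (dual_crossed (crossed A)) (gmx regular_gset A) :=
  GAlgHom takai_hom takai_act.

Definition takai_inv : gmx regular_gset A -> dual_crossed (crossed A) :=
  lext (fun p a => delta p.1 (delta (p.1^-1 * p.2)%g (gact p.1^-1%g a))).

Let takai_inv_genD (p : G * G) :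
  {morph (fun a : A => delta p.1 (delta (p.1^-1 * p.2)%g (gact p.1^-1%g a))) : a b / a + b}.
Proof. by move=> a b; rewrite gactD !deltaD. Qed.

Lemma takai_iso : is_iso (takai : hom (galg_cat sg G) _ _).
Proof.
have invD : {morph takai_inv : x y / x + y} := lextD takai_inv_genD.
apply: (galg_iso (f := takai) (g := takai_inv)).
  apply: (eq_on_span gens (f := takai_inv \o takai) (g := id)) => // [x y|].
    by rewrite /= takai_funD invD.
  move=> _ [g [_ [[h [a [_ ->]]] ->]]].
  by rewrite /= takai_fun_delta /takai_inv (lext_delta takai_inv_genD) /= -gactM mulVg gact1 mulKg.
apply: (eq_on_span (gmx_spans (spans_all A) regular_gset) (f := takai \o takai_inv) (g := id))
  => // [x y|].
  by rewrite /= invD takai_funD.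
move=> _ [[g h] [a [_ ->]]].
by rewrite /= /takai_inv (lext_delta takai_inv_genD) /= takai_fun_delta -gactM mulgV gact1 mulVKg.
Qed.

End TakaiEquivariant.

Section TakaiGraded.
Variables (l : comPzRingType) (sg : conjugation l) (G : groupType) (B : gralg sg G).

Definition tautological_grset : grset G := @GrSet G G id.

Let decB := dec (gdeg_sum B).

Let fsmap_decL (S : choiceType) (W : lmodType l) (u : G -> S) (f : B -> W) :
  linear f -> linear (fun b => fsmap u f (decB b)).
Proof. by move=> fL c a b; rewrite /decB decD decZ (fsmap_linear u fL). Qed.

(** For b homogeneous of degree k, (chi_g |x b) x| h goes to e_{g, h^-1 g k} b: the
    column index is the one for which this matrix has degree
    g k (h^-1 g k)^-1 = h. *)
Definition gr_takai_fun : crossed (dual_crossed B) -> grmx tautological_grset B :=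
  lext2 (fun h g b => fsmap (fun k => (g, (h^-1 * g * k)%g)) id (decB b)).

Lemma gr_takai_fun_linear : linear gr_takai_fun.
Proof. by apply: lext2_linear => h g; apply: fsmap_decL. Qed.

Definition gr_takai_funD := linear_additive gr_takai_fun_linear.

Lemma gr_takai_fun_delta h g k b : gdeg k b ->
  gr_takai_fun (delta h (delta g b)) = delta (g, (h^-1 * g * k)%g) b.
Proof.
move=> Db; rewrite /gr_takai_fun lext2_delta.
  by rewrite /decB (dec_hom _ Db) fsmap_delta.
by move=> {}h {}g a c; rewrite /decB decD fsmapD.
Qed.

Let homB := spans_homogeneous B.
Let gens := crossed_spans (dual_spans homB).

Lemma gr_takai_hom : is_star_hom gr_takai_fun.
Proof.
apply: (star_hom_on_span gens); first exact: gr_takai_fun_linear.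
  move=> _ _ [h [_ [[g [b [[k Db] ->]]] ->]]] [h' [_ [[g' [c [[k' Dc] ->]]] ->]]].
  rewrite crossed_smul dual_act_delta (dual_smul _ _ _ Db).
  rewrite (gr_takai_fun_delta _ _ Db) (gr_takai_fun_delta _ _ Dc) grmx_smul /=.
  rewrite [_ == g']eq_sym -[g' == _](inj_eq (mulgI h)) !mulgA mulgV mul1g.
  case: eqP => [e|_]; last by rewrite delta0 (additive0 gr_takai_funD).
  rewrite (gr_takai_fun_delta _ _ (gdegM Db Dc)); congr (delta (_, _) _).
  by rewrite invgM -!mulgA [(g * (k * k'))%g]mulgA -e -!mulgA mulKg.
move=> _ [h [_ [[g [b [[k Db] ->]]] ->]]].
rewrite crossed_star (dual_star _ Db) dual_act_delta (gr_takai_fun_delta _ _ (gdegS Db)).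
rewrite (gr_takai_fun_delta _ _ Db) grmx_star; congr (delta (_, _) _); rewrite /= !mulgA //.
by rewrite invgK mulgV mul1g mulgK.
Qed.

Lemma gr_takai_deg h x : gdeg h x -> gdeg h (gr_takai_fun x).
Proof.
move: h x; apply: (crossed_deg_on_span (dual_spans homB)); first exact: gr_takai_funD.
move=> h _ [g [b [[k Db] ->]]]; rewrite (gr_takai_fun_delta _ _ Db).
have := @grmx_deg_delta _ _ _ tautological_grset _ _ g (h^-1 * g * k)%g _ Db.
by rewrite /= !invgM invgK !mulgA mulgK mulgV mul1g.
Qed.

Definition gr_takai : gralg_hom (crossed (dual_crossed B)) (grmx tautological_grset B) :=
  GrAlgHom gr_takai_hom gr_takai_deg.

Let inv_gen (p : G * G) (b : B) : fs G (fs G B) :=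
  fsmap (fun k => (p.1 * k * p.2^-1)%g) (@delta l G B p.1) (decB b).

Lemma gr_takai_iso : is_iso (gr_takai : hom (gralg_cat sg G) _ _).
Proof.
have genD p : {morph inv_gen p : a b / a + b}.
  by apply: linear_additive; apply: fsmap_decL; exact: delta_linear.
pose inv : grmx tautological_grset B -> crossed (dual_crossed B) := lext inv_gen.
have invD : {morph inv : x y / x + y} := lextD genD.
have invE g h k b : gdeg k b -> inv (delta (g, h) b) = delta (g * k * h^-1)%g (delta g b).
  move=> Db; rewrite /inv (lext_delta genD) /inv_gen /decB (dec_hom _ Db) fsmap_delta //.
  exact: deltaD.
apply: (gralg_iso (f := gr_takai) (g := inv)).
  apply: (eq_on_span gens (f := inv \o gr_takai) (g := id)) => // [x y|].
    by rewrite /= gr_takai_funD invD.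
  move=> _ [h [_ [[g [b [[k Db] ->]]] ->]]] /=.
  rewrite (gr_takai_fun_delta _ _ Db) (invE _ _ _ _ Db) !invgM invgK !mulgA.
  by rewrite mulgK mulgV mul1g.
apply: (eq_on_span (grmx_spans homB tautological_grset) (f := gr_takai \o inv) (g := id))
  => // [x y|].
  by rewrite /= invD gr_takai_funD.
move=> _ [[g h] [b [[k Db] ->]]] /=.
by rewrite (invE _ _ _ _ Db) (gr_takai_fun_delta _ _ Db) !invgM invgK -!mulgA mulKg mulVg mulg1.
Qed.

End TakaiGraded.
(** * Stability and exactness of the crossed product functors *)

Section StabilityTransfer.
Variables (l : comPzRingType) (sg : conjugation l) (G : groupType) (frakX : choiceType).

(** The isomorphisms [crossed_mx] reduce both matrix stabilities of H o (- x| G) to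
    those of H for trivially graded index sets. *)
Lemma crossed_stable (O' : Type) (D : category O') (H0 : gralg sg G -> O')
    (H : functor (gralg_cat sg G) D H0) :
  grhermitian_stable frakX H ->
  ghermitian_stable frakX (comp_functor H (crossed_functor sg G)).
Proof.
move=> [sG sh sX si]; split.
- move=> A X Y X0 cX cY.
  have hg := sG (crossed A) (triv_grset G X) (triv_grset G Y) X0 cX cY.
  exact: (is_iso_square_image (crossed_mx_iso A _) (crossed_mx_iso A _)
    (crossed_mx_inl A X Y) hg).
- move=> A; have e := crossed_pl_const A; rewrite -[RHS]gralg_compm1 in e.
  exact: (is_iso_square_image (iso_id (gralg_cat sg G) _) (crossed_pl_iso A) e).
- move=> A x; have e := crossed_mx_corner A x; rewrite -[RHS]gralg_compm1 in e.
  exact: (is_iso_square_image (iso_id (gralg_cat sg G) _) (crossed_mx_iso A _) e).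
- move=> A; have e := crossed_pm_corner A; rewrite -[RHS]gralg_compm1 in e.
  exact: (is_iso_square_image (iso_id (gralg_cat sg G) _) (crossed_pm_iso A) e).
Qed.

Lemma dual_stable (O' : Type) (D : category O') (H0 : galg sg G -> O')
    (H : functor (galg_cat sg G) D H0) :
  ghermitian_stable frakX H ->
  grhermitian_stable frakX (comp_functor H (dual_crossed_functor sg G)).
Proof.
move=> [sG sh sX si]; split.
- move=> B [X dX] [Y dY] X0 cX cY.
  have hg := sG (dual_crossed B) (triv_gset G X) (triv_gset G Y) X0 cX cY.
  have hX := @dual_mx_iso l sg G B (triv_gset G X) dX (fun _ _ => erefl).
  have hXY := @dual_mx_iso l sg G B (sum_gset (triv_gset G X) (triv_gset G Y))
    (@grset_deg G (sum_grset (GrSet dX) (GrSet dY)))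
    (fun _ z => match z with inl _ => erefl | inr _ => erefl end).
  exact: (is_iso_square_image hX hXY (dual_mx_inl B dX dY) hg).
- move=> B; have e := dual_pl_const B; rewrite -[RHS]galg_compm1 in e.
  exact: (is_iso_square_image (iso_id (galg_cat sg G) _) (dual_pl_iso B) e).
- move=> B x; have e := dual_mx_corner B x; rewrite -[RHS]galg_compm1 in e.
  exact: (is_iso_square_image (iso_id (galg_cat sg G) _) (dual_mx_iso B _ _) e).
- move=> B; have e := dual_pm_corner B; rewrite -[RHS]galg_compm1 in e.
  exact: (is_iso_square_image (iso_id (galg_cat sg G) _) (dual_pm_iso B) e).
Qed.
End StabilityTransfer.

Section ExactFunctors.
Variables (l : comPzRingType) (sg : conjugation l) (G : groupType).

Lemma crossed_exact :
  @exact_functor _ _ (galg_extcat sg G) (gralg_extcat sg G) _ (crossed_functor sg G).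
Proof.
move=> A B C i p [[iI ip _] [s [sL sA sK]]]; have sD := linear_additive sL.
split; first exact: (fsmap_exact G (shD (galg_funP i)) (shD (galg_funP p)) sD iI ip sK).
exists (fsmap id s); split.
- exact: fsmap_linear.
- by move=> g _ [c ->]; exists (s c); rewrite fsmap_delta.
- move=> x; apply: fs_eqP => t; rewrite /= !fsmap_idE //; exact: shD (galg_funP p).
Qed.

Lemma dual_crossed_exact :
  @exact_functor _ _ (gralg_extcat sg G) (galg_extcat sg G) _ (dual_crossed_functor sg G).
Proof.
move=> A B C i p [[iI ip _] [s [sL sA sK]]]; have sD := linear_additive sL.
split; first exact: (fsmap_exact G (shD (gralg_funP i)) (shD (gralg_funP p)) sD iI ip sK).
exists (fsmap id s); split.
- exact: fsmap_linear.
- move=> g x; rewrite [LHS]fsmap_comp // [RHS]fsmap_comp //.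
- move=> x; apply: fs_eqP => t; rewrite /= !fsmap_idE //; exact: shD (gralg_funP p).
Qed.
End ExactFunctors.

Section EquivariantMatrixFunctor.
Variables (l : comPzRingType) (sg : conjugation l) (G : groupType) (X : gset G).

Section Map.
Variables (A B : galg sg G) (f : galg_hom A B).
Let fD := shD (galg_funP f).

Lemma gmx_map_hom : @is_star_hom l sg (gmx X A) (gmx X B) (fsmap id f).
Proof.
apply: fsmap_star_hom => [|p a q b|p a]; first exact: shL (galg_funP f).
  by rewrite /mx_gm; case: eqP => _; rewrite ?fsmap_delta ?fsmap0 ?(shM (galg_funP f)).
by rewrite /mx_gs fsmap_delta // (shS (galg_funP f)).
Qed.

Lemma gmx_map_act g (x : gmx X A) :
  (fsmap id f (gact g x) : gmx X B) = gact g (fsmap id f x : gmx X B).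
Proof.
rewrite [LHS]fsmap_comp //; last exact: gactD.
rewrite [RHS]fsmap_comp //; last exact: gactD.
by apply: eq_fsmap => // a; exact: galg_fun_act.
Qed.

Definition gmx_map : galg_hom (gmx X A) (gmx X B) :=
  @GAlgHom l sg G (gmx X A) (gmx X B) _ gmx_map_hom gmx_map_act.
End Map.

Lemma gmx_map1 (A : galg sg G) : gmx_map (galg_id A) = galg_id (gmx X A).
Proof. by apply: galg_hom_eq => x; apply: fsmap_id. Qed.

Lemma gmx_mapM (A B C : galg sg G) (g : galg_hom B C) (f : galg_hom A B) :
  gmx_map (galg_comp g f) = galg_comp (gmx_map g) (gmx_map f).
Proof.
apply: galg_hom_eq => x; rewrite [RHS]fsmap_comp //.
- exact: shD (galg_funP f).
- exact: shD (galg_funP g).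
Qed.

Definition gmx_functor : functor (galg_cat sg G) (galg_cat sg G) (gmx X) :=
  @Functor _ _ (galg_cat sg G) (galg_cat sg G) (gmx X) gmx_map gmx_map1 gmx_mapM.

Lemma gmx_exact :
  @exact_functor _ _ (galg_extcat sg G) (galg_extcat sg G) _ gmx_functor.
Proof.
move=> A B C i p [[iI ip _] [s [sL sA sK]]]; have sD := linear_additive sL.
split; first exact: (fsmap_exact _ (shD (galg_funP i)) (shD (galg_funP p)) sD iI ip sK).
exists (fsmap id s); split.
- exact: fsmap_linear.
- move=> g x; rewrite [LHS]fsmap_comp //; last exact: gactD.
  rewrite [RHS]fsmap_comp //; last exact: gactD.
  by apply: eq_fsmap => // a; exact: sA.
- move=> x; apply: fs_eqP => t; rewrite /= !fsmap_idE //; exact: shD (galg_funP p).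
Qed.
End EquivariantMatrixFunctor.

Section GradedMatrixFunctor.
Variables (l : comPzRingType) (sg : conjugation l) (G : groupType) (X : grset G).

Section Map.
Variables (A B : gralg sg G) (f : gralg_hom A B).
Let fD := shD (gralg_funP f).

Lemma grmx_map_hom : @is_star_hom l sg (grmx X A) (grmx X B) (fsmap id f).
Proof.
apply: fsmap_star_hom => [|p a q b|p a]; first exact: shL (gralg_funP f).
  by rewrite /mx_gm; case: eqP => _; rewrite ?fsmap_delta ?fsmap0 ?(shM (gralg_funP f)).
by rewrite /mx_gs fsmap_delta // (shS (gralg_funP f)).
Qed.

Lemma grmx_map_deg g (x : grmx X A) : gdeg g x -> gdeg g (fsmap id f x : grmx X B).
Proof. by move=> Dx p; rewrite fsmap_idE //; apply: gralg_fun_deg; exact: Dx. Qed.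

Definition grmx_map : gralg_hom (grmx X A) (grmx X B) :=
  @GrAlgHom l sg G (grmx X A) (grmx X B) _ grmx_map_hom grmx_map_deg.
End Map.

Lemma grmx_map1 (A : gralg sg G) : grmx_map (gralg_id A) = gralg_id (grmx X A).
Proof. by apply: gralg_hom_eq => x; apply: fsmap_id. Qed.

Lemma grmx_mapM (A B C : gralg sg G) (g : gralg_hom B C) (f : gralg_hom A B) :
  grmx_map (gralg_comp g f) = gralg_comp (grmx_map g) (grmx_map f).
Proof.
apply: gralg_hom_eq => x; rewrite [RHS]fsmap_comp //.
- exact: shD (gralg_funP f).
- exact: shD (gralg_funP g).
Qed.

Definition grmx_functor : functor (gralg_cat sg G) (gralg_cat sg G) (grmx X) :=
  @Functor _ _ (gralg_cat sg G) (gralg_cat sg G) (grmx X) grmx_map grmx_map1 grmx_mapM.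

Lemma grmx_exact :
  @exact_functor _ _ (gralg_extcat sg G) (gralg_extcat sg G) _ grmx_functor.
Proof.
move=> A B C i p [[iI ip _] [s [sL sA sK]]]; have sD := linear_additive sL.
split; first exact: (fsmap_exact _ (shD (gralg_funP i)) (shD (gralg_funP p)) sD iI ip sK).
exists (fsmap id s); split.
- exact: fsmap_linear.
- by move=> g x Dx q; rewrite fsmap_idE //; apply: sA; exact: Dx.
- move=> x; apply: fs_eqP => t; rewrite /= !fsmap_idE //; exact: shD (gralg_funP p).
Qed.
End GradedMatrixFunctor.
(** * Duality for stable theories *)

Section Cardinals.
Variables (G : groupType) (frakX : choiceType).
Hypothesis frakX_card : ([set: (G + nat)%type] #<= [set: frakX])%card.

Lemma card_group_le : ([set: G] #<= [set: frakX])%card.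
Proof.
apply: card_le_trans frakX_card.
have inlI : {in (@inl G nat) @^-1` [set: G + nat] &, injective (@inl G nat)}.
  by move=> g h _ _ [].
by have := card_ge_preimage inlI; rewrite preimage_setT.
Qed.

Lemma card_unit_le : ([set: unit] #<= [set: frakX])%card.
Proof.
apply: card_le_trans frakX_card.
pose f (_ : unit) := inr 0%N : G + nat.
have fI : {in f @^-1` [set: G + nat] &, injective f} by case=> [] [].
by have := card_ge_preimage fI; rewrite preimage_setT.
Qed.
End Cardinals.

Definition sum_swap (S T : Type) (z : S + T) : T + S :=
  match z with inl s => inr s | inr t => inl t end.

Lemma sum_swapK (S T : Type) : cancel (@sum_swap S T) (@sum_swap T S).
Proof. by case. Qed.

Section EquivariantDuality.
Variables (l : comPzRingType) (sg : conjugation l) (G : groupType).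

Definition gmx_swap_fun (A : galg sg G) (X Y : gset G) :
    gmx (sum_gset X Y) A -> gmx (sum_gset Y X) A :=
  fsmap (fun p => (sum_swap p.1, sum_swap p.2)) id.

Section Swap.
Variables (A : galg sg G) (X Y : gset G).

Lemma gmx_swap_hom : is_star_hom (@gmx_swap_fun A X Y).
Proof.
apply: fsmap_star_hom => // [p a q b|p a]; rewrite ?/mx_gs ?fsmap_delta //.
rewrite /mx_gm /= (inj_eq (can_inj (@sum_swapK X Y))).
by case: eqP => _; rewrite ?fsmap_delta ?fsmap0.
Qed.

Lemma gmx_swap_act g x : @gmx_swap_fun A X Y (gact g x) = gact g (gmx_swap_fun x).
Proof.
rewrite [LHS]fsmap_comp //; last exact: gactD.
rewrite [RHS]fsmap_comp //; last exact: gactD.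
by apply: eq_fsmap => // -[[x1|x1] [y1|y1]].
Qed.

Definition gmx_swap : galg_hom (gmx (sum_gset X Y) A) (gmx (sum_gset Y X) A) :=
  GAlgHom gmx_swap_hom gmx_swap_act.

End Swap.

Lemma gmx_swap_iso (A : galg sg G) (X Y : gset G) :
  is_iso (gmx_swap A X Y : hom (galg_cat sg G) _ _).
Proof.
have K (X' Y' : gset G) (x : gmx (sum_gset X' Y') A) : gmx_swap_fun (gmx_swap_fun x) = x.
  rewrite [LHS]fsmap_comp //; apply: fsmap_id => // p /=.
  by rewrite !sum_swapK; case: p.
exact: (galg_iso (f := gmx_swap A X Y) (g := @gmx_swap_fun A Y X)) (K _ _) (K _ _).
Qed.

Lemma gmx_corner_unit_iso (A : galg sg G) :
  is_iso (gmx_corner A tt : hom (galg_cat sg G) _ _).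
Proof.
apply: (galg_iso (f := gmx_corner A tt) (g := fun x => (x : fs _ _) (tt, tt))).
  by move=> a; rewrite [LHS]deltaE eqxx.
by move=> x; apply: fs_eqP => -[[] []]; rewrite [LHS]deltaE eqxx.
Qed.

Let pt := triv_gset G unit.
Let reg := regular_gset G.

(** The matrices over 1 + G receive both A, through the point 1, and
    G |x (A x| G) = M_G A. The swap is there because the stability axiom inverts
    only the inclusion of the left summand. *)
Definition corner_leg (A : galg sg G) : galg_hom A (gmx (sum_gset pt reg) A) :=
  galg_comp (gmx_inl A pt reg) (gmx_corner A tt).

Definition takai_leg (A : galg sg G) :
    galg_hom (dual_crossed (crossed A)) (gmx (sum_gset pt reg) A) :=
  galg_comp (gmx_swap A reg pt) (galg_comp (gmx_inl A reg pt) (takai A)).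

Lemma corner_leg_nat (A B : galg sg G) (f : galg_hom A B) :
  galg_comp (corner_leg B) f = galg_comp (gmx_map (sum_gset pt reg) f) (corner_leg A).
Proof.
have fD := shD (galg_funP f).
by apply: galg_hom_eq => a; rewrite /= /mx_inl !fsmap_delta.
Qed.

Lemma takai_leg_nat (A B : galg sg G) (f : galg_hom A B) :
  galg_comp (takai_leg B) (dual_crossed_map (crossed_map f)) =
  galg_comp (gmx_map (sum_gset pt reg) f) (takai_leg A).
Proof.
have fD := shD (galg_funP f).
apply: (galg_hom_eq_on_span (dual_spans (crossed_spans (spans_all A)))).
move=> _ [g [_ [[h [a [_ ->]]] ->]]] /=; rewrite fsmap_delta; last exact: fsmapD.
rewrite fsmap_delta // !takai_fun_delta /mx_inl /gmx_swap_fun !fsmap_delta //.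
by rewrite galg_fun_act.
Qed.

Variable frakX : choiceType.
Hypothesis frakX_card : ([set: (G + nat)%type] #<= [set: frakX])%card.

Section Legs.
Variables (O' : Type) (D : category O') (H0 : galg sg G -> O').
Variable (H : functor (galg_cat sg G) D H0).
Hypothesis Hst : gG_stable frakX H.

Lemma corner_leg_inverted (A : galg sg G) :
  is_iso (fmap H (corner_leg A : hom (galg_cat sg G) _ _)).
Proof.
rewrite [corner_leg A]/(comp (gmx_inl A pt reg : hom (galg_cat sg G) _ _) _) fmapM.
apply: iso_comp; last exact: (fmap_iso H (gmx_corner_unit_iso A)).
apply: (Hst A (X := pt) (Y := reg)); first by exists tt.
  exact: card_unit_le frakX_card.
exact: card_group_le frakX_card.
Qed.

Lemma takai_leg_inverted (A : galg sg G) :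
  is_iso (fmap H (takai_leg A : hom (galg_cat sg G) _ _)).
Proof.
rewrite [takai_leg A]/(comp (gmx_swap A reg pt : hom (galg_cat sg G) _ _)
  (comp (gmx_inl A reg pt : hom (galg_cat sg G) _ _) (takai A : hom (galg_cat sg G) _ _))).
rewrite !fmapM; apply: iso_comp; first exact: (fmap_iso H (gmx_swap_iso A reg pt)).
apply: iso_comp; last exact: (fmap_iso H (takai_iso A)).
apply: (Hst A (X := reg) (Y := pt)); first by exists 1%g.
  exact: card_group_le frakX_card.
exact: card_unit_le frakX_card.
Qed.
End Legs.

Lemma takai_theory_iso (U : Type) (T : tricat U) (H0 : galg sg G -> U)
    (H : excisive_theory (galg_extcat sg G) T H0) : gG_stable frakX H ->
  exists eta, theory_iso H
    (theory_precomp (@crossed_exact l sg G) (theory_precomp (@dual_crossed_exact l sg G) H)) eta.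
Proof.
move=> Hst.
apply: (theory_iso_cospan (H'' := theory_precomp (@gmx_exact l sg G (sum_gset pt reg)) H)
  (eta := fun A => fmap H (corner_leg A : hom (galg_cat sg G) _ _))
  (theta := fun A => fmap H (takai_leg A : hom (galg_cat sg G) _ _))).
- apply: (nat_theory_iso (Phi := id_functor (galg_extcat sg G)) (fun _ _ _ _ _ e => e)).
    exact: corner_leg_nat.
  exact: corner_leg_inverted.
(* The two composite theories agree on morphisms and boundary maps, but as
   records they differ by proofs. *)
- have [] := @nat_theory_iso _ _ _ (galg_extcat sg G) (galg_extcat sg G) T _ _
    (comp_functor (dual_crossed_functor sg G) (crossed_functor sg G))
    (gmx_functor sg (sum_gset pt reg))
    (fun _ _ _ _ _ e => dual_crossed_exact (crossed_exact e)) (@gmx_exact l sg G _) H0 H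
    takai_leg takai_leg_nat (takai_leg_inverted Hst).
  by move=> hi hn hb; split; [exact: hi | exact: hn | exact: hb].
Qed.
End EquivariantDuality.
Section GradedDuality.
Variables (l : comPzRingType) (sg : conjugation l) (G : groupType).

Definition grmx_swap_fun (A : gralg sg G) (X Y : grset G) :
    grmx (sum_grset X Y) A -> grmx (sum_grset Y X) A :=
  fsmap (fun p => (sum_swap p.1, sum_swap p.2)) id.

Section Swap.
Variables (A : gralg sg G) (X Y : grset G).

Lemma grmx_swap_hom : is_star_hom (@grmx_swap_fun A X Y).
Proof.
apply: fsmap_star_hom => // [p a q b|p a]; rewrite ?/mx_gs ?fsmap_delta //.
rewrite /mx_gm /= (inj_eq (can_inj (@sum_swapK X Y))).
by case: eqP => _; rewrite ?fsmap_delta ?fsmap0.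
Qed.

Lemma grmx_swap_deg g x : gdeg g x -> gdeg g (@grmx_swap_fun A X Y x).
Proof.
move=> Dx p; have sK (p' : (X + Y) * (X + Y)) :
    (sum_swap (sum_swap p'.1), sum_swap (sum_swap p'.2)) = p'.
  by rewrite !sum_swapK; case: p'.
rewrite (@fsmapE _ _ _ _ _ _ _ _ (fun q => (sum_swap q.1, sum_swap q.2))) //; last first.
  by move=> q; rewrite /= !sum_swapK; case: q.
have := Dx (sum_swap p.1, sum_swap p.2).
by case: p => [[u|u] [v|v]].
Qed.

Definition grmx_swap : gralg_hom (grmx (sum_grset X Y) A) (grmx (sum_grset Y X) A) :=
  GrAlgHom grmx_swap_hom grmx_swap_deg.
End Swap.

Lemma grmx_swap_iso (A : gralg sg G) (X Y : grset G) :
  is_iso (grmx_swap A X Y : hom (gralg_cat sg G) _ _).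
Proof.
have K (X' Y' : grset G) (x : grmx (sum_grset X' Y') A) : grmx_swap_fun (grmx_swap_fun x) = x.
  rewrite [LHS]fsmap_comp //; apply: fsmap_id => // p /=.
  by rewrite !sum_swapK; case: p.
exact: (gralg_iso (f := grmx_swap A X Y) (g := @grmx_swap_fun A Y X)) (K _ _) (K _ _).
Qed.

Lemma grmx_corner_unit_iso (A : gralg sg G) :
  is_iso (grmx_corner A tt : hom (gralg_cat sg G) _ _).
Proof.
apply: (gralg_iso (f := grmx_corner A tt) (g := fun x => (x : fs _ _) (tt, tt))).
  by move=> a; rewrite [LHS]deltaE eqxx.
by move=> x; apply: fs_eqP => -[[] []]; rewrite [LHS]deltaE eqxx.
Qed.

Let pt := triv_grset G unit.
Let taut := tautological_grset G.

(** The same two corners; the point has degree 1, so that B is its own matrix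
    algebra there. *)
Definition gr_corner_leg (B : gralg sg G) : gralg_hom B (grmx (sum_grset pt taut) B) :=
  gralg_comp (grmx_inl B pt taut) (grmx_corner B tt).

Definition gr_takai_leg (B : gralg sg G) :
    gralg_hom (crossed (dual_crossed B)) (grmx (sum_grset pt taut) B) :=
  gralg_comp (grmx_swap B taut pt) (gralg_comp (grmx_inl B taut pt) (gr_takai B)).

Lemma gr_corner_leg_nat (A B : gralg sg G) (f : gralg_hom A B) :
  gralg_comp (gr_corner_leg B) f = gralg_comp (grmx_map (sum_grset pt taut) f) (gr_corner_leg A).
Proof.
have fD := shD (gralg_funP f).
by apply: gralg_hom_eq => a; rewrite /= /mx_inl !fsmap_delta.
Qed.

Lemma gr_takai_leg_nat (A B : gralg sg G) (f : gralg_hom A B) :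
  gralg_comp (gr_takai_leg B) (crossed_map (dual_crossed_map f)) =
  gralg_comp (grmx_map (sum_grset pt taut) f) (gr_takai_leg A).
Proof.
have fD := shD (gralg_funP f).
apply: (gralg_hom_eq_on_span (crossed_spans (dual_spans (spans_homogeneous A)))).
move=> _ [h [_ [[g [a [[k Da] ->]]] ->]]] /=; rewrite fsmap_delta; last exact: fsmapD.
rewrite fsmap_delta // (gr_takai_fun_delta _ _ Da) (gr_takai_fun_delta _ _ (gralg_fun_deg f Da)).
by rewrite /mx_inl /grmx_swap_fun !fsmap_delta.
Qed.

Variable frakX : choiceType.
Hypothesis frakX_card : ([set: (G + nat)%type] #<= [set: frakX])%card.

Section Legs.
Variables (O' : Type) (D : category O') (H0 : gralg sg G -> O').
Variable (H : functor (gralg_cat sg G) D H0).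
Hypothesis Hst : grG_stable frakX H.

Lemma gr_corner_leg_inverted (A : gralg sg G) :
  is_iso (fmap H (gr_corner_leg A : hom (gralg_cat sg G) _ _)).
Proof.
rewrite [gr_corner_leg A]/(comp (grmx_inl A pt taut : hom (gralg_cat sg G) _ _) _) fmapM.
apply: iso_comp; last exact: (fmap_iso H (grmx_corner_unit_iso A)).
apply: (Hst A (X := pt) (Y := taut)); first by exists tt.
  exact: card_unit_le frakX_card.
exact: card_group_le frakX_card.
Qed.

Lemma gr_takai_leg_inverted (A : gralg sg G) :
  is_iso (fmap H (gr_takai_leg A : hom (gralg_cat sg G) _ _)).
Proof.
rewrite [gr_takai_leg A]/(comp (grmx_swap A taut pt : hom (gralg_cat sg G) _ _)
  (comp (grmx_inl A taut pt : hom (gralg_cat sg G) _ _) (gr_takai A : hom (gralg_cat sg G) _ _))).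
rewrite !fmapM; apply: iso_comp; first exact: (fmap_iso H (grmx_swap_iso A taut pt)).
apply: iso_comp; last exact: (fmap_iso H (gr_takai_iso A)).
apply: (Hst A (X := taut) (Y := pt)); first by exists 1%g.
  exact: card_group_le frakX_card.
exact: card_unit_le frakX_card.
Qed.
End Legs.

Lemma gr_takai_theory_iso (U : Type) (T : tricat U) (H0 : gralg sg G -> U)
    (H : excisive_theory (gralg_extcat sg G) T H0) : grG_stable frakX H ->
  exists eta, theory_iso H
    (theory_precomp (@dual_crossed_exact l sg G) (theory_precomp (@crossed_exact l sg G) H)) eta.
Proof.
move=> Hst.
apply: (theory_iso_cospan (H'' := theory_precomp (@grmx_exact l sg G (sum_grset pt taut)) H)
  (eta := fun A => fmap H (gr_corner_leg A : hom (gralg_cat sg G) _ _))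
  (theta := fun A => fmap H (gr_takai_leg A : hom (gralg_cat sg G) _ _))).
- apply: (nat_theory_iso (Phi := id_functor (gralg_extcat sg G)) (fun _ _ _ _ _ e => e)).
    exact: gr_corner_leg_nat.
  exact: gr_corner_leg_inverted.
(* The two composite theories agree on morphisms and boundary maps, but as
   records they differ by proofs. *)
- have [] := @nat_theory_iso _ _ _ (gralg_extcat sg G) (gralg_extcat sg G) T _ _
    (comp_functor (crossed_functor sg G) (dual_crossed_functor sg G))
    (grmx_functor sg (sum_grset pt taut))
    (fun _ _ _ _ _ e => crossed_exact (dual_crossed_exact e)) (@grmx_exact l sg G _) H0 H
    gr_takai_leg gr_takai_leg_nat (gr_takai_leg_inverted Hst).
  by move=> hi hn hb; split; [exact: hi | exact: hn | exact: hb].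
Qed.
End GradedDuality.

Theorem theorem8p1 (l : comPzRingType) (sg : conjugation l) (G : groupType)
    (frakX : choiceType) (lam : l)
    (hlam : lam + sg lam = 1)
    (frakX_infinite : infinite_set [set: frakX])
    (frakX_card : ([set: (G + nat)%type] #<= [set: frakX])%card)
    (K : kkh_equivariant sg G frakX) (L : kkh_graded sg G frakX) :
  exists (F : trifunctor (kk K) (kk L) (@crossed l sg G))
         (F' : trifunctor (kk L) (kk K) (@dual_crossed l sg G)),
    [/\ forall (A B : galg sg G) (f : galg_hom A B),
          fmap F (fmap (jj K) f) = fmap (jj L) (fmap (crossed_functor sg G) f),
        forall (A B : gralg sg G) (f : gralg_hom A B),
          fmap F' (fmap (jj L) f) = fmap (jj K) (fmap (dual_crossed_functor sg G) f),
        tri_natiso (comp_trifunctor F' F) (id_trifunctor (kk K))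
      & tri_natiso (comp_trifunctor F F') (id_trifunctor (kk L))].
Proof.
have KP := jj_prop K; have LP := jj_prop L.
have KLP := dual_stable KP; have LKP := crossed_stable LP.
have [F hF] := @jj_extend _ _ _ K _ _ _ (theory_precomp (@crossed_exact l sg G) (jj L)) LKP.
have [F' hF'] := @jj_extend _ _ _ L _ _ _ (theory_precomp (@dual_crossed_exact l sg G) (jj K)) KLP.
have [eta heta] : exists eta, theory_iso (jj K) (theory_precomp (@crossed_exact l sg G)
    (theory_precomp (@dual_crossed_exact l sg G) (jj K))) eta.
  by apply: (takai_theory_iso frakX_card); case: KP.
have [theta htheta] : exists theta, theory_iso (jj L) (theory_precomp (@dual_crossed_exact l sg G)
    (theory_precomp (@crossed_exact l sg G) (jj L))) theta.
  by apply: (gr_takai_theory_iso frakX_card); case: LP.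
exists F, F'; split.
- exact: (proj1 hF).
- exact: (proj1 hF').
- exact: (comp_natiso_id hF hF' (crossed_stable KLP) heta).
- exact: (comp_natiso_id hF' hF (dual_stable LKP) htheta).
Qed.
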